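(* Let $K$ be a field of characteristic zero, $R=K[x,y,z]$, and let $A=R/I$ be artinian, where $I=(L_1^{a_1},\dots,L_s^{a_s})$ is generated by powers of general linear forms $L_1,\dots,L_s$ ($a_i$ positive integers). Let $\ell,L\in R$ be two general linear forms. Then the following are equivalent: (a) $A/\ell^3A$ has the Strong Lefschetz Property; (b) for every integer $b$ with $3\le b\le p(A)$, multiplication by $\ell^3$ on $A/L^bA$ has maximal rank in each degree; (c) for every integer $b$ with $3\le b\le p(A)$, the map $\times\ell^3:[A/L^bA]_{j-1}\to[A/L^bA]_{j+2}$ has maximal rank, where $j=p(A/L^bA)$.
   Context: For an algebra $B=R/(M_1^{c_1},\dots,M_r^{c_r})$ with $M_i$ linear forms, $p(B)=\max\{j\mid \sum_{c_i\le j}(j+1-c_i)\le j\}$ (sum over empty set is zero); thus $p(A)$ is computed from $a_1,\dots,a_s$ and $p(A/L^bA)$ from $a_1,\dots,a_s,b$. A map has maximal rank if it is injective or surjective; ''maximal rank in each degree'' for multiplication by a form of degree $e$ means this for $[B]_{j-e}\to[B]_j$ for all $j$. $B$ has the Strong Lefschetz Property if for a general linear form $M$, multiplication by $M^d$ has maximal rank in each degree for every $d\ge1$. ''General'' means in a suitable nonempty Zariski open set. *)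

(* Defs.v *)
From HB Require Import structures.
From mathcomp Require Import all_boot all_order all_algebra.
From mathcomp Require Import mpoly.
Set Implicit Arguments. Unset Strict Implicit. Unset Printing Implicit Defensive.
Import Order.TTheory GRing.Theory.
Local Open Scope ring_scope.

Section Defs.
Variable K : fieldType.

(* "general": a property of points of K^n holds on a nonempty Zariski open
   set, i.e. on a basic open set D(f) = {f <> 0} with f a nonzero polynomial. *)
Definition general (n : nat) (P : ('I_n -> K) -> Prop) : Prop :=
  exists f : {mpoly K[n]}, f != 0 /\ forall v : 'I_n -> K, f.@[v] != 0 -> P v.

Definition linform (c : 'I_3 -> K) : {mpoly K[3]} := \sum_(i < 3) c i *: 'X_i.

Definition in_ideal (gs : seq {mpoly K[3]}) (f : {mpoly K[3]}) : Prop :=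
  exists h : 'I_(size gs) -> {mpoly K[3]}, f = \sum_(i < size gs) h i * gs`_i.

(* B = R/(gs).  Elements of [B]_k (k : int) are represented by forms of degree k;
   for k < 0 the only representative is 0.  [deg_rep e j f] : f represents an
   element of [B]_(j-e) (integer degree j-e). *)
Definition deg_rep (e j : nat) (f : {mpoly K[3]}) : Prop :=
  if (e <= j)%N then f \is (j - e)%N.-homog else f == 0.

Definition mult_inj (gs : seq {mpoly K[3]}) (F : {mpoly K[3]}) (e j : nat) : Prop :=
  forall f, deg_rep e j f -> in_ideal gs (F * f) -> in_ideal gs f.

Definition mult_surj (gs : seq {mpoly K[3]}) (F : {mpoly K[3]}) (e j : nat) : Prop :=
  forall g, g \is j.-homog -> exists f, deg_rep e j f /\ in_ideal gs (g - F * f).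

Definition max_rank (gs : seq {mpoly K[3]}) (F : {mpoly K[3]}) (e j : nat) : Prop :=
  mult_inj gs F e j \/ mult_surj gs F e j.

(* maximal rank in each degree (target degrees j < 0 are trivial: target is 0) *)
Definition max_rank_all (gs : seq {mpoly K[3]}) (F : {mpoly K[3]}) (e : nat) : Prop :=
  forall j : nat, max_rank gs F e j.

Definition SLP (gs : seq {mpoly K[3]}) : Prop :=
  general (fun c : 'I_3 -> K => forall d : nat, (1 <= d)%N ->
             max_rank_all gs (linform c ^+ d) d).

(* artinian standard graded quotient R/(gs): all forms of some degree lie in (gs)
   (equivalently [R/(gs)]_N = 0 for N >> 0, i.e. R/(gs) finite dimensional) *)
Definition artinian (gs : seq {mpoly K[3]}) : Prop :=
  exists N : nat, forall f : {mpoly K[3]}, f \is N.-homog -> in_ideal gs f.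

Definition coordn (n : nat) (v : 'I_n -> K) (m : nat) : K :=
  if insub m is Some i then v i else 0.

Definition kth_form (n : nat) (v : 'I_n -> K) (k : nat) : {mpoly K[3]} :=
  linform (fun j : 'I_3 => coordn v (3 * k + j)).
End Defs.

(* p(B) for B = R/(M_1^{c_1},...,M_r^{c_r}):
   max { j | \sum_{c_i <= j} (j+1-c_i) <= j }.  j = 0 always qualifies (c_i >= 1),
   and when r >= 2 and all c_i >= 1 every qualifying j is < sumn cs, so the max
   below is exactly the max of the (finite) set. *)
Definition p_cond (cs : seq nat) (j : nat) : bool :=
  (\sum_(c <- cs | c <= j) (j.+1 - c) <= j)%N.
Definition p_of (cs : seq nat) : nat :=
  (\max_(j < (sumn cs).+1 | p_cond cs j) j)%N.

(* Main.v *)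
(* Write m_i = max(0, d + 1 - a_i). By Macaulay duality, filling degree d of
   R / (ell^k) by the L_i^{a_i} means that no plane curve of degree d has
   multiplicity d + 1 - k at the point of ell and m_i at the points of the L_i.
   On the algebraic side this is proved by differentiation: along u, a power
   L^a either is a constant (L(u) = 0) or becomes L^(a-1), so if the ideal
   contains the forms of degree d killed by u, the question drops to degree
   d - 1.  For k = 1 this settles powers of distinct binary linear forms; for
   k <= 3 one puts the points of the L_i on k lines and lets u remove one line
   at a time from the curves.  Fullness is a Zariski open
   condition, and when the dimensions add up it forces independence, so for
   general forms the expected behaviour holds in degree p + 1 for k <= 3.  In
   degree p + 2 and for k = 3 the only failure is corank one (a double curve),
   and there a general power L^(p+2) still fills the quotient.
   The equivalence then follows by comparing the cokernel A / (ell^3, L^b) of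
   the two multiplications L^b on A / ell^3 and ell^3 on A / L^b: for b <= p they
   agree up to injectivity of L^b and ell^3 on A, which is known in the relevant
   degrees, and for every b except in degree p(A / L^b) + 2 the maximal rank
   of ell^3 is automatic. *)
Require Import Defs.
From HB Require Import structures.
From mathcomp Require Import all_boot all_order all_algebra.
From mathcomp Require Import mpoly.
From mathcomp Require Import zify ring.
From Stdlib Require Classical_Prop.
Set Implicit Arguments. Unset Strict Implicit. Unset Printing Implicit Defensive.
Import GRing.Theory.
Local Open Scope ring_scope.

(** * Homogeneous ideals *)

Section Ideals.
Variable K : fieldType.
Notation R := {mpoly K[3]}.
Implicit Types (f g h : R) (gs : seq R).

Lemma in_ideal_cons gs g f :
  in_ideal (g :: gs) f <-> exists h, in_ideal gs (f - h * g).
Proof.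
split.
  case=> h ->; exists (h ord0); exists (fun i => h (lift ord0 i)).
  by rewrite /= big_ord_recl /= addrC addKr; apply: eq_bigr.
case=> h [k e].
exists (fun i : 'I_(size (g :: gs)) =>
          if unlift ord0 i is Some j then k j else h).
rewrite /= big_ord_recl unlift_none /= -[LHS](subrK (h * g)) e addrC.
by congr (_ + _); apply: eq_bigr => i _; rewrite liftK.
Qed.

Lemma in_ideal_nil f : in_ideal [::] f <-> f = 0.
Proof.
split; first by case=> h ->; rewrite big_ord0.
by move=> ->; exists (fun=> 0); rewrite big_ord0.
Qed.

Lemma in_ideal0 gs : in_ideal gs 0.
Proof. by exists (fun=> 0); rewrite big1 // => i _; rewrite mul0r. Qed.

Lemma in_idealD gs f g : in_ideal gs f -> in_ideal gs g -> in_ideal gs (f + g).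
Proof.
case=> h -> [k ->]; exists (fun i => h i + k i).
by rewrite -big_split; apply: eq_bigr => i _; rewrite mulrDl.
Qed.

Lemma in_idealMl gs h f : in_ideal gs f -> in_ideal gs (h * f).
Proof.
case=> k ->; exists (fun i => h * k i).
by rewrite big_distrr; apply: eq_bigr => i _; rewrite /= mulrA.
Qed.

Lemma in_idealMr gs h f : in_ideal gs f -> in_ideal gs (f * h).
Proof. by rewrite mulrC; apply: in_idealMl. Qed.

Lemma in_idealN gs f : in_ideal gs f -> in_ideal gs (- f).
Proof. by rewrite -mulN1r; apply: in_idealMl. Qed.

Lemma in_ideal_sum gs (I : Type) (r : seq I) (P : pred I) (F : I -> R) :
  (forall i, P i -> in_ideal gs (F i)) -> in_ideal gs (\sum_(i <- r | P i) F i).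
Proof.
by move=> h; apply: big_ind => //; [apply: in_ideal0 | apply: in_idealD].
Qed.

Lemma in_ideal_gen gs g : g \in gs -> in_ideal gs g.
Proof.
elim: gs => // x gs IH; rewrite inE => /orP[/eqP->|/IH h].
  by apply/in_ideal_cons; exists 1; rewrite mul1r subrr; apply: in_ideal0.
by apply/in_ideal_cons; exists 0; rewrite mul0r subr0.
Qed.

Lemma in_ideal_ind gs (P : R -> Prop) :
  P 0 -> (forall f g, P f -> P g -> P (f + g)) ->
  (forall h g, g \in gs -> P (h * g)) -> forall f, in_ideal gs f -> P f.
Proof.
move=> P0 PD PM f [h ->]; apply: big_ind => // i _.
by apply/PM/mem_nth.
Qed.

Lemma in_ideal_trans gs gs' f :
  (forall g, g \in gs -> in_ideal gs' g) -> in_ideal gs f -> in_ideal gs' f.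
Proof.
move=> h; apply: in_ideal_ind; [exact: in_ideal0 | exact: in_idealD |].
by move=> k g /h; apply: in_idealMl.
Qed.

Lemma in_ideal_sub gs gs' f :
  {subset gs <= gs'} -> in_ideal gs f -> in_ideal gs' f.
Proof. by move=> h; apply: in_ideal_trans => g /h; apply: in_ideal_gen. Qed.

Lemma in_ideal_rcons gs g f :
  in_ideal (rcons gs g) f <-> exists h, in_ideal gs (f - h * g).
Proof.
split.
  move=> h; apply/in_ideal_cons; apply: in_ideal_sub h => x.
  by rewrite mem_rcons.
move/in_ideal_cons; apply: in_ideal_sub => x; by rewrite mem_rcons.
Qed.

Lemma in_ideal1 g f : in_ideal [:: g] f <-> exists h, f = h * g.
Proof.
split.
  by case/in_ideal_cons=> h /in_ideal_nil /eqP; rewrite subr_eq0 => /eqP ->; exists h.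
by case=> h ->; apply/in_idealMl/in_ideal_gen; rewrite inE.
Qed.

(** Split [p] into homogeneous components: only the one of degree [d - c] can contribute, and none
    does when [d < c]. *)
Lemma mul_pihomog (n d c : nat) (p q : {mpoly K[n]}) : q \is c.-homog ->
  pihomog mdeg d (p * q) =
  if (c <= d)%N then pihomog mdeg (d - c) p * q else 0.
Proof.
move=> hq.
have {1}-> := @pihomog_partitionE n K mdeg (msize p) p (leqnn _).
rewrite big_distrl raddf_sum /=.
have hM (i : nat) : pihomog mdeg i p * q \is (i + c).-homog.
  by apply: dhomogM => //; apply: pihomogP.
case: leqP => [le_cd|lt_dc]; last first.
  rewrite big1 // => i _; rewrite (pihomog_ne0 _ (hM i)) //; lia.
have [lt|ge] := ltnP (d - c) (msize p).
  rewrite (bigD1 (Ordinal lt)) //= big1 ?addr0; last first.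
    move=> i ne; rewrite (pihomog_ne0 _ (hM i)) //.
    by apply: contra ne => /eqP e; apply/eqP/val_inj => /=; lia.
  by rewrite pihomog_dE // -{2}(subnK le_cd) hM.
rewrite big1 => [|i _]; last by rewrite (pihomog_ne0 _ (hM i)) //; have := ltn_ord i; lia.
suff -> : pihomog mdeg (d - c) p = 0 by rewrite mul0r.
rewrite pihomogE big_seq_cond big1 // => m /andP[hm /eqP e].
by move: (msize_mdeg_lt hm); rewrite e; lia.
Qed.

(* A system is a list of generators tagged with their degrees. *)
Definition homog_sys (s : seq (R * nat)) : bool :=
  all (fun p => p.1 \is p.2.-homog) s.

(** Vanishing of [R/(gs)]_d. For [F :: gs] this is the vanishing of the cokernel of multiplication
    by [F] on R/(gs), the form in which surjectivity is used below. *)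
Definition full gs d := forall f, f \is d.-homog -> in_ideal gs f.

Lemma full_trans gs gs' d :
  (forall g, g \in gs -> in_ideal gs' g) -> full gs d -> full gs' d.
Proof. by move=> h H f /H; apply: in_ideal_trans. Qed.

Lemma in_ideal_pihomog (s : seq (R * nat)) d f : homog_sys s ->
  in_ideal (unzip1 s) f -> in_ideal (unzip1 s) (pihomog mdeg d f).
Proof.
move=> /allP hs; move: f; apply: in_ideal_ind.
- by rewrite pihomog0; apply: in_ideal0.
- by move=> p q; rewrite pihomogD; apply: in_idealD.
move=> h g hg; have /mapP[[g' c] /hs /= hc eg] := hg.
rewrite -{}eg in hc; rewrite (mul_pihomog _ _ hc).
by case: ifP => _; [apply/in_idealMl/in_ideal_gen | apply: in_ideal0].
Qed.

(** Taking the component of degree [d] of an arbitrary relation makes the cofactor of [g]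
    homogeneous. *)
Lemma in_ideal_cons_homog (s : seq (R * nat)) d c g f :
  homog_sys s -> g \is c.-homog -> f \is d.-homog ->
  in_ideal (g :: unzip1 s) f ->
  exists2 h, deg_rep c d h & in_ideal (unzip1 s) (f - h * g).
Proof.
move=> hs hg hf /in_ideal_cons[h /(in_ideal_pihomog d hs)].
rewrite pihomogB pihomog_dE // (mul_pihomog _ _ hg) /deg_rep.
case: ifP => _ H; first by exists (pihomog mdeg (d - c) h) => //; apply: pihomogP.
by exists 0; rewrite ?eqxx // mul0r.
Qed.

Lemma deg_repM c d g h : g \is c.-homog -> deg_rep c d h -> g * h \is d.-homog.
Proof.
rewrite /deg_rep; case: leqP => [le hg hh|_ _ /eqP->]; last first.
  by rewrite mulr0; apply: dhomog0.
by rewrite -(subnKC le); apply: dhomogM.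
Qed.

Lemma max_rank_surjE (s : seq (R * nat)) c d g : homog_sys s -> g \is c.-homog ->
  mult_surj (unzip1 s) g c d <-> full (g :: unzip1 s) d.
Proof.
move=> hs hg; split=> H f hf.
  have [h [_ Hh]] := H f hf; apply/in_ideal_cons; exists h.
  by rewrite [h * g]mulrC.
have [h dh Hh] := in_ideal_cons_homog hs hg hf (H f hf).
by exists h; split=> //; rewrite mulrC.
Qed.

End Ideals.

(** * Directional derivatives in characteristic zero *)

Section DirectionalDerivative.
Variables (K : fieldType) (n : nat).
Notation R := {mpoly K[n]}.
Implicit Types (f g h w : R) (u : 'I_n -> K).

Lemma mpoly_ring_ind (P : R -> Prop) :
  (forall c, P c%:MP) -> (forall i, P 'X_i) ->
  (forall f g, P f -> P g -> P (f + g)) ->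
  (forall f g, P f -> P g -> P (f * g)) -> forall f, P f.
Proof.
move=> PC PX PD PM; elim/mpolyind; first by rewrite -mpolyC0.
move=> c m p _ _ Pp; apply: (PD) => //; rewrite -mul_mpolyC; apply: (PM) => //.
rewrite mpolyXE_id; apply: big_ind => [||i _]; [exact: (PC 1) | exact: (PM) |].
elim: (m i) => [|k IH]; first exact: (PC 1).
by rewrite exprS; apply: (PM).
Qed.

Definition deru u f : R := \sum_(i < n) u i *: f^`M(i).

Lemma deruD u f g : deru u (f + g) = deru u f + deru u g.
Proof.
by rewrite /deru -big_split; apply: eq_bigr => i _; rewrite /= mderivD scalerDr.
Qed.

Lemma deruZ u c f : deru u (c *: f) = c *: deru u f.
Proof.
rewrite /deru scaler_sumr; apply: eq_bigr => i _.
by rewrite mderivZ !scalerA mulrC.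
Qed.

Lemma deru0 u : deru u 0 = 0.
Proof. by have := deruZ u 0 0; rewrite !scale0r. Qed.

Lemma deruB u f g : deru u (f - g) = deru u f - deru u g.
Proof. by rewrite deruD -scaleN1r deruZ scaleN1r. Qed.

Lemma deruM u f g : deru u (f * g) = deru u f * g + f * deru u g.
Proof.
rewrite /deru big_distrl big_distrr -big_split; apply: eq_bigr => i _ /=.
by rewrite mderivM scalerDr scalerAl scalerAr.
Qed.

Lemma deruC u c : deru u c%:MP = 0.
Proof. by rewrite /deru big1 // => i _; rewrite mderivC scaler0. Qed.

Lemma deruX u i : deru u 'X_i = (u i)%:MP.
Proof.
rewrite /deru (bigD1 i) //= big1 ?addr0 => [|j ne].
  rewrite mderivX mnm1E eqxx scale1r.
  have -> : (U_(i) - U_(i) = 0 :> 'X_{1..n})%MM.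
    by apply/mnmP=> k; rewrite mnmBE subnn mnm0E.
  by rewrite mpolyX0 -alg_mpolyC.
by rewrite mderivX mnm1E eq_sym (negbTE ne) scale0r scaler0.
Qed.

Lemma deruXn u f k : deru u (f ^+ k.+1) = f ^+ k * deru u f *+ k.+1.
Proof.
elim: k => [|k IH]; first by rewrite !expr1 expr0 mul1r.
rewrite exprS deruM IH mulrnAr mulrA -exprS [deru u f * _]mulrC.
by rewrite [RHS]mulrS.
Qed.

Lemma deru_homog u f d : f \is d.-homog -> deru u f \is d.-1.-homog.
Proof.
move=> /dhomogP hf; apply: rpred_sum => i _; apply: rpredZ.
apply/dhomogP => m; rewrite mcoeff_msupp mcoeff_deriv => ne.
have /hf : (m + U_(i))%MM \in msupp f.
  by rewrite mcoeff_msupp; apply: contraNneq ne => ->; rewrite mul0rn.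
by rewrite /= mdegD mdeg1; lia.
Qed.

Lemma deru_nilp u f : exists r, iter r (deru u) f = 0.
Proof.
exists (msize f); move: (leqnn (msize f)); move: {2 3}(msize f) => r.
elim: r f => [|r IH] f; first by rewrite leqn0 msize_poly_eq0 => /eqP.
move=> hf; rewrite iterSr; apply: IH.
rewrite msizeE; apply/bigmax_leqP_seq => m hm _.
have [i _ hi] : exists2 i, true & m \in msupp f^`M(i).
  apply/exists_inP; apply: contraTT hm => /existsPn h.
  rewrite mcoeff_msupp negbK /deru raddf_sum big1 // => i _.
  rewrite /= mcoeffZ; have := h i; rewrite /= mcoeff_msupp negbK => /eqP ->.
  by rewrite mulr0.
move: hi; rewrite mcoeff_msupp mcoeff_deriv => ne.
have /msize_mdeg_lt : (m + U_(i))%MM \in msupp f.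
  by rewrite mcoeff_msupp; apply: contraNneq ne => ->; rewrite mul0rn.
by rewrite mdegD mdeg1; lia.
Qed.

Hypothesis charK : [pchar K] =i pred0.

Lemma natr_neq0 k : k.+1%:R != 0 :> K.
Proof. by have /pcharf0P -> := charK. Qed.

Lemma mpoly_mulrn_eq0 f k : f *+ k.+1 = 0 -> f = 0.
Proof.
move/eqP; rewrite -scaler_nat -mul_mpolyC mulf_eq0 mpolyC_eq0.
by rewrite (negbTE (natr_neq0 k)) => /eqP.
Qed.

(* The correction term [L * deru u g] is absorbed by recursion on the order
   of nilpotency of [deru u] at [g], raising the power of [L]. *)
Lemma deru_solve u L a g c : deru u L = c%:MP -> c != 0 ->
  exists h, deru u (L ^+ a.+1 * h) = L ^+ a * g.
Proof.
move=> hL nc; have [r] := deru_nilp u g.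
elim: r a g => [|r IH] a g.
  by move=> /= ->; exists 0; rewrite !mulr0 deru0.
rewrite iterSr => /(IH a.+1)[h' e'].
pose x := c * a.+1%:R; have nx : x != 0 by rewrite mulf_neq0 // natr_neq0.
exists (x^-1 *: (g - L * h')).
rewrite -scalerAr mulrBr mulrA -exprSr deruZ deruB e' deruM deruXn hL addrK.
have -> : (L ^+ a * c%:MP) *+ a.+1 * g = x *: (L ^+ a * g).
  by rewrite -mul_mpolyC /x mpolyCM mpolyC_nat; ring.
by rewrite scalerA mulVf // scale1r.
Qed.

Lemma deru_onto u w g c : deru u w = c%:MP -> c != 0 ->
  exists h, deru u h = g.
Proof.
move=> hw nc; have [h] := deru_solve 0 g hw nc.
by rewrite expr0 mul1r expr1 => e; exists (w * h).
Qed.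

(** The substitution that moves a point along [u] by the polynomial amount [- w]; a good choice of
    [w] eliminates a variable. *)
Definition slide u w f : R := mmap (@mpolyC n K) (fun i => 'X_i - u i *: w) f.

Lemma slideD u w f g : slide u w (f + g) = slide u w f + slide u w g.
Proof. exact: rmorphD. Qed.

Lemma slideM u w f g : slide u w (f * g) = slide u w f * slide u w g.
Proof. exact: rmorphM. Qed.

Lemma slideC u w c : slide u w c%:MP = c%:MP.
Proof. exact: mmapC. Qed.

Lemma slideX u w i : slide u w 'X_i = 'X_i - u i *: w.
Proof. by rewrite /slide mmapX mmap1U. Qed.

Lemma slide_id u w f : deru u f = 0 -> slide u w f = f.
Proof.
move=> hf.
(* [T f] is [f (x + tau u)]; its derivative in [tau] is [T (deru u f)], so it is
   constant and [tau = - w] gives the claim. *)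
have [T [TC TX TD TM]] : exists T : R -> {poly R}, [/\
    forall c, T c%:MP = (c%:MP)%:P,
    forall i, T 'X_i = ('X_i)%:P + ((u i)%:MP)%:P * 'X,
    forall p q, T (p + q) = T p + T q & forall p q, T (p * q) = T p * T q].
  exists (mmap (polyC \o @mpolyC n K)
    (fun i => ('X_i)%:P + ((u i)%:MP)%:P * 'X : {poly R})).
  split=> [c|i|p q|p q]; [by rewrite mmapC | by rewrite mmapX mmap1U | |].
  - exact: rmorphD.
  - exact: rmorphM.
have T0 g : (T g).[0] = g.
  elim/mpoly_ring_ind: g => [c|i|p q e1 e2|p q e1 e2].
  - by rewrite TC hornerC.
  - by rewrite TX !hornerE.
  - by rewrite TD hornerD e1 e2.
  - by rewrite TM hornerM e1 e2.
have Tw g : (T g).[- w] = slide u w g.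
  elim/mpoly_ring_ind: g => [c|i|p q e1 e2|p q e1 e2].
  - by rewrite TC hornerC slideC.
  - by rewrite TX !hornerE slideX mulrN mul_mpolyC.
  - by rewrite TD hornerD e1 e2 slideD.
  - by rewrite TM hornerM e1 e2 slideM.
have dT g : (T g)^`() = T (deru u g).
  elim/mpoly_ring_ind: g => [c|i|p q e1 e2|p q e1 e2].
  - by rewrite TC derivC deruC -mpolyC0 TC polyC0.
  - by rewrite TX derivD derivC add0r derivM derivC mul0r add0r derivX mulr1 deruX TC.
  - by rewrite TD derivD e1 e2 deruD TD.
  - by rewrite TM derivM e1 e2 deruM TD !TM.
have cst : T f = ((T f)`_0)%:P.
  apply/polyP=> -[|i]; rewrite coefC //=.
  apply: (@mpoly_mulrn_eq0 _ i); rewrite -coef_deriv dT hf -mpolyC0 TC.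
  by rewrite polyC0 coef0.
by rewrite -Tw cst hornerC -[RHS]T0 cst hornerC coefC.
Qed.

End DirectionalDerivative.

(** * Filling a degree by differentiation *)

Lemma uniq_map_inj (T1 T2 : eqType) (f : T1 -> T2) (s : seq T1) :
  uniq (map f s) -> {in s &, injective f}.
Proof.
elim: s => //= x s IH /andP[/mapP nfx /IH fi] y z; rewrite !inE.
case/predU1P=> [->|ys] /predU1P[->|zs] e //; last exact: fi.
  by case: nfx; exists z.
by case: nfx; exists y.
Qed.

Section Degeneration.
Variable K : fieldType.
Hypothesis charK : [pchar K] =i pred0.
Notation R := {mpoly K[3]}.
Notation form := ('I_3 -> K).
Notation i2 := (Ordinal (isT : 2 < 3)%N).
Implicit Types (f g h : R) (u w c : form) (s : seq (form * nat)) (gs : seq R).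

Definition ev c u : K := \sum_(i < 3) c i * u i.

Lemma linform_homog c : linform c \is (1%N).-homog.
Proof. by apply: rpred_sum => i _; rewrite rpredZ // dhomogX /= mdeg1. Qed.

Lemma linformX_homog c k : linform c ^+ k \is k.-homog.
Proof. by have := dhomogMn k (linform_homog c); rewrite mul1n. Qed.

Lemma deru_linform u c : deru u (linform c) = (ev c u)%:MP.
Proof.
rewrite /linform /ev !big_ord_recl !big_ord0 !deruD !deruZ !deruX deru0.
by rewrite !mpolyCD !mpolyCM mpolyC0 !mul_mpolyC.
Qed.

Lemma mcoeff_pihomog (n d : nat) (p : {mpoly K[n]}) m :
  (pihomog mdeg d p)@_m = if mdeg m == d then p@_m else 0.
Proof.
elim/mpolyind: p => [|c m' p _ _ IH]; first by rewrite pihomog0 mcoeff0 if_same.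
rewrite linearD linearZ /= pihomogX mcoeffD IH mcoeffZ mcoeffD mcoeffZ mcoeffX.
have [<-|ne] := eqVneq m' m.
  by case: ifP => _; rewrite ?mcoeffX ?eqxx // mcoeff0 mulr0 addr0.
have -> : (if mdeg m' == d then 'X_[m'] else 0 : {mpoly K[n]})@_m = 0.
  by case: ifP => _; rewrite ?mcoeff0 // mcoeffX (negbTE ne).
by case: ifP => _; rewrite mulr0 add0r.
Qed.

Lemma deru_pihomog u d f : deru u f = 0 -> deru u (pihomog mdeg d f) = 0.
Proof.
move=> /mpolyP hf; apply/mpolyP => m; have := hf m.
rewrite !mcoeff0 /deru !raddf_sum /= => e.
have [ed|ned] := eqVneq (mdeg m).+1 d.
  rewrite -[RHS]e; apply: eq_bigr => i _.
  by rewrite !mcoeffZ !mcoeff_deriv mcoeff_pihomog mdegD mdeg1 addn1 ed eqxx.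
rewrite big1 // => i _; rewrite mcoeffZ mcoeff_deriv mcoeff_pihomog.
by rewrite mdegD mdeg1 addn1 (negbTE ned) mul0rn mulr0.
Qed.

Definition powers s : seq R := [seq linform p.1 ^+ p.2 | p <- s].
Definition psys s : seq (R * nat) := [seq (linform p.1 ^+ p.2, p.2) | p <- s].

Lemma powersE s : powers s = unzip1 (psys s).
Proof. by rewrite /unzip1 -map_comp. Qed.

Lemma psys_homog s : homog_sys (psys s).
Proof. by elim: s => //= p s ->; rewrite linformX_homog. Qed.

(** Truncated subtraction keeps a generator with exponent 0 equal to 1, so the unit ideal stays the
    unit ideal. *)
Definition lower u s := [seq (p.1, p.2 - (ev p.1 u != 0%R))%N | p <- s].

(** The form [w] makes the derivation along [u] surjective on R, which treats the cofactors of the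
    powers it sees as constants; for the other powers [deru_solve] finds the antiderivative inside
    the ideal. *)
Lemma powers_lower_onto u w s g : ev w u = 1 ->
  in_ideal (powers (lower u s)) g ->
  exists2 h, in_ideal (powers s) h & deru u h = g.
Proof.
move=> wu; have dw : deru u (linform w) = 1%:MP by rewrite deru_linform wu.
have onto k := deru_onto charK k dw (oner_neq0 K).
move: g; apply: in_ideal_ind.
- by exists 0; [apply: in_ideal0 | apply: deru0].
- move=> p q [h1 i1 <-] [h2 i2 <-]; exists (h1 + h2); first exact: in_idealD.
  by rewrite deruD.
rewrite /powers /lower -map_comp => k g hg.
have [[c a] /= [hin ->]] : exists p,
    in_ideal (powers s) (linform p.1 ^+ p.2) /\
    g = linform p.1 ^+ (p.2 - (ev p.1 u != 0%R))%N.
  elim: s hg => // p s IH; rewrite inE => /orP[/eqP ->|/IH[q [hq ->]]].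
    by exists p; split=> //; apply: in_ideal_gen; rewrite inE eqxx.
  exists q; split=> //; apply: in_ideal_sub hq => x xs.
  by rewrite inE [x \in _]xs orbT.
have [e0|ne0] := eqVneq (ev c u) 0.
  have [h <-] := onto k; exists (linform c ^+ a * h); first exact: in_idealMr.
  rewrite subn0 deruM; case: a hin => [|a] _; first by rewrite expr0 deruC; ring.
  by rewrite deruXn deru_linform e0 mulr0 mul0rn mul0r add0r mulrC.
case: a hin => [|a] hin.
  have [h <-] := onto k; exists h; last by rewrite mulr1.
  by rewrite -[h]mulr1; apply: in_idealMl.
have [h e] := deru_solve charK a k (deru_linform u c) ne0.
by exists (linform c ^+ a.+1 * h); [apply: in_idealMr | rewrite e subn1 mulrC].
Qed.

(** An antiderivative of [deru u f] inside the ideal differs from [f] by a polynomial killed by [u],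
    whose component of degree [d.+1] is covered by the hypothesis on the kernel. *)
Lemma full_step u w s d : ev w u = 1 ->
  (forall f, f \is d.+1.-homog -> deru u f = 0 -> in_ideal (powers s) f) ->
  full (powers (lower u s)) d -> full (powers s) d.+1.
Proof.
move=> wu hker hfull f hf.
have [h hin e] := powers_lower_onto wu (hfull _ (deru_homog u hf)).
rewrite -(pihomog_dE hf) -(subrK h f) pihomogD; apply: in_idealD.
  apply: hker; first exact: pihomogP.
  by apply: deru_pihomog; rewrite deruB e subrr.
by move: hin; rewrite powersE; apply/in_ideal_pihomog/psys_homog.
Qed.

Definition mkform (x y z : K) : form := fun i => nth 0 [:: x; y; z] i.
Definition ez := mkform 0 0 1.
(** The form x + t y + zeta z. In the dual plane, a fixed t gives a line through the point of [ez],
    and a fixed zeta (a level) gives a line that avoids it. *)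
Definition pt (p : K * K) := mkform 1 p.1 p.2.
Definition pts (s : seq (K * K * nat)) := [seq (pt p.1, p.2) | p <- s].

Lemma ev_mkform x y z x' y' z' :
  ev (mkform x y z) (mkform x' y' z') = x * x' + y * y' + z * z'.
Proof. by rewrite /ev !big_ord_recl big_ord0 /= addr0 addrA. Qed.

Lemma linform_mkform x y z : linform (mkform x y z) =
  x *: 'X_0 + y *: 'X_1 + z *: 'X_i2.
Proof.
rewrite /linform !big_ord_recl big_ord0 /= addr0 addrA.
congr (_ + _ *: 'X_ _ + _ *: 'X_ _); exact/val_inj.
Qed.

Lemma linform_ez : linform ez = 'X_i2.
Proof. by rewrite linform_mkform !scale0r !add0r scale1r. Qed.

Lemma linform_pt t z : linform (pt (t, z)) = 'X_0 + t *: 'X_1 + z *: linform ez.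
Proof. by rewrite linform_ez linform_mkform /= scale1r. Qed.

(** Every term of the binomial expansion has exponent at least [a] in [x] or at least [k.+1] in
    [y]. *)
Lemma in_ideal_exprD gs (x y : R) a k :
  in_ideal gs (x ^+ a) -> in_ideal gs (y ^+ k.+1) -> in_ideal gs ((x + y) ^+ (a + k)).
Proof.
move=> hx hy; rewrite exprDn; apply: in_ideal_sum => i _.
rewrite -mulr_natr; apply: in_idealMr.
have [le|lt] := leqP i k.
  apply: in_idealMr; rewrite -addnBA // exprD; exact: in_idealMr.
by apply: in_idealMl; rewrite -(subnKC lt) exprD; apply: in_idealMr.
Qed.

(* A form killed by the derivation along the common zero of [z] and [L] is a
   polynomial in [z] and [L], hence a multiple of [L ^+ d] modulo [z]. *)
Lemma ker_deru_line gs p d f :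
  f \is d.-homog -> deru (mkform (- p.1) 1 0) f = 0 ->
  in_ideal gs (linform ez) -> in_ideal gs (linform (pt p) ^+ d) ->
  in_ideal gs f.
Proof.
(* Sliding by y sends x to x + t y and y to 0 and fixes z, so only monomials in x + t y and z
   survive. *)
case: p => t z /= hf df hz hL; rewrite -(slide_id charK 'X_1 df).
rewrite /slide /mmap big_seq_cond; apply: in_ideal_sum => m; rewrite andbT => hm.
apply: in_idealMl; rewrite /mmap1 !big_ord_recl big_ord0 mulr1 /=.
rewrite scale1r scale0r subr0 scaleNr opprK.
have -> : lift ord0 (ord0 : 'I_2) = 1 by apply/val_inj.
have -> : lift ord0 (lift ord0 (ord0 : 'I_1)) = i2.
  exact/val_inj.
rewrite subrr -linform_ez.
have /= := dhomog_mf hf hm; rewrite mdegE !big_ord_recl big_ord0 /=.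
have -> : lift ord0 (ord0 : 'I_2) = 1 by apply/val_inj.
have -> : lift ord0 (lift ord0 (ord0 : 'I_1)) = i2.
  exact/val_inj.
case: (m i2) => [|k]; last first.
  by move=> _; rewrite exprS; do 2 apply: in_idealMl; apply: in_idealMr.
case: (m 1) => [|k] e; last by rewrite exprS !mul0r mulr0; apply: in_ideal0.
rewrite !expr0 !mulr1; have -> : m ord0 = (d + 0)%N by lia.
have -> : 'X_ord0 + t *: 'X_1 = linform (pt (t, z)) + - z *: linform ez.
  by rewrite linform_pt scaleNr addrK.
apply: in_ideal_exprD => //; rewrite expr1 -mul_mpolyC; exact: in_idealMl.
Qed.

Lemma full_one gs d : in_ideal gs 1 -> full gs d.
Proof. by move=> h f _; rewrite -[f]mulr1; apply: in_idealMl. Qed.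

Lemma powers_pts l (q : seq (K * K * nat)) : powers (l :: pts q) =
  linform l.1 ^+ l.2 :: [seq linform (pt p.1) ^+ p.2 | p <- q].
Proof. by rewrite /powers /pts /= -map_comp. Qed.

Lemma in_ideal_pt l (q : seq (K * K * nat)) p : p \in q ->
  in_ideal (powers (l :: pts q)) (linform (pt p.1) ^+ p.2).
Proof.
move=> pq; apply: in_ideal_gen; rewrite powers_pts inE; apply/orP; right.
exact: map_f pq.
Qed.

Lemma full_pt0 l (q : seq (K * K * nat)) p d : p \in q -> p.2 = 0%N ->
  full (powers (l :: pts q)) d.
Proof. by move=> /(in_ideal_pt l) h p0; apply: full_one; move: h; rewrite p0. Qed.

(* Induction on [d], differentiating along the common zero of [z] and of one of
   the generators. *)
Lemma full_binary (q : seq (K * K * nat)) k d :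
  uniq [seq p.1.1 | p <- q] -> (k <= 1)%N ->
  (d < \sum_(p <- q) (d.+1 - p.2))%N ->
  full (powers ((ez, k) :: pts q)) d.
Proof.
case: k => [|[|//]] uq _.
  by move=> _; apply/full_one/in_ideal_gen; rewrite inE expr0 eqxx.
elim: d q uq => [|d IH] q uq hq.
  have [/hasP[p pq /eqP p0]|/hasPn nz] := boolP (has (fun p => p.2 == 0%N) q).
    exact: full_pt0 pq p0.
  by move: hq; rewrite big_seq big1 // => p /nz /=; lia.
have [/hasP[p pq /eqP p0]|/hasPn nz] := boolP (has (fun p => p.2 == 0%N) q).
  exact: full_pt0 pq p0.
have [/hasP[p pq hp]|/hasPn no] := boolP (has (fun p => p.2 <= d.+1)%N q); last first.
  by move: hq; rewrite big_seq big1 // => p /no /=; lia.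
have uq' : uniq q by apply: map_uniq uq.
(* The common zero of z and of the form of [p]; no other form of [q] vanishes there, because the
   first coordinates are distinct. *)
pose u := mkform (- p.1.1) 1 0.
apply: (@full_step u (mkform 0 1 0)); first by rewrite ev_mkform; ring.
  move=> f hf df; refine (ker_deru_line hf df _ _).
    by apply: in_ideal_gen; rewrite inE expr1 eqxx.
  by rewrite -(subnKC hp) exprD; apply/in_idealMr/in_ideal_pt.
have -> : lower u ((ez, 1%N) :: pts q) =
    (ez, 1%N) :: pts [seq (p'.1, p'.2 - (p'.1.1 != p.1.1))%N | p' <- q].
  rewrite /lower /= ev_mkform !mul0r mulr0 !addr0 eqxx; congr cons.
  rewrite /pts -!map_comp; apply: eq_map => p' /=.
  by rewrite ev_mkform mulr1 mulr0 mul1r addr0 addrC subr_eq0.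
apply: IH; first by rewrite -map_comp.
rewrite big_map /=; move: hq; rewrite !(bigD1_seq p) //= eqxx.
(* The summand of [p] drops by one. The others do not change, as their positive exponents drop
   together with the degree. So the sum falls by exactly one, like the degree. *)
rewrite (_ : \sum_(i <- q | i != p) (d.+2 - i.2) =
             \sum_(i <- q | i != p) (d.+1 - (i.2 - (i.1.1 != p.1.1))))%N; first by move: hp => /=; rewrite subn0; lia.
rewrite big_seq_cond [RHS]big_seq_cond; apply: eq_bigr => i /andP[iq ne].
have -> : i.1.1 != p.1.1.
  by apply: contra ne => /eqP e; rewrite (uniq_map_inj uq iq pq e).
by have := nz i iq; rewrite /= -lt0n; lia.
Qed.

(** This slide sends z to 0 and x to x + z0 z, hence replaces the level of every form by [z0]. *)
Lemma slide_pt z0 t z : slide (mkform (- z0) 0 1) (linform ez) (linform (pt (t, z)))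
  = linform (pt (t, z0)).
Proof.
rewrite !linform_pt linform_ez -!mul_mpolyC !slideD !slideM !slideC !slideX /=.
rewrite -!mul_mpolyC mpolyC1 mpolyC0 mpolyCN; ring.
Qed.

(* Differentiating along the vertex of the pencil of level [z0]: the forms of
   that level are constants for this derivation. *)
Lemma full_level (q : seq (K * K * nat)) z0 k d :
  uniq [seq p.1.1 | p <- q] ->
  (d < \sum_(p <- q) (d.+1 - (p.2 + k * (p.1.2 != z0))))%N ->
  (d = 0%N \/ full (powers ((ez, k) ::
     pts [seq (p.1, p.2 - (p.1.2 != z0))%N | p <- q])) d.-1) ->
  full (powers ((ez, k.+1) :: pts q)) d.
Proof.
(* [q1] moves every form to level [z0]. This changes the form by a multiple of z, and z^(k+1) lies
   in the ideal, so the moved form still has a power in the ideal once the exponent is raised by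
   [k]. *)
move=> uq hq; pose q1 := [seq ((p.1.1, z0), p.2 + k * (p.1.2 != z0))%N | p <- q].
have hz : in_ideal (powers ((ez, k.+1) :: pts q)) (linform ez ^+ k.+1).
  by apply: in_ideal_gen; rewrite inE eqxx.
case: d hq => [|d] hq.
  have [/hasP[p pq /eqP p0] _|/hasPn nz] := boolP (has (fun p => p.2 == 0%N) q).
    exact: full_pt0 pq p0.
  by move: hq; rewrite big_seq big1 // => p /nz /=; lia.
case=> // hfull; pose u := mkform (- z0) 0 1.
apply: (@full_step u ez); first by rewrite ev_mkform; ring.
  move=> f hf df.
  have uq1 : uniq [seq p.1.1 | p <- q1] by rewrite -map_comp.
  have hq1 : (d.+1 < \sum_(p <- q1) (d.+2 - p.2))%N by rewrite big_map.
  have /in_ideal_cons[h] := full_binary uq1 (leqnn 1) hq1 hf.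
  rewrite expr1 => H.
  have sz : slide u (linform ez) (linform ez) = 0.
    by rewrite linform_ez slideX scale1r subrr.
  (* Sliding fixes [f], which is killed by [u], and sends z to 0, so the multiple of z
     disappears. *)
  have -> : f = slide u (linform ez) (f - h * linform ez).
    rewrite slideD -mulNr slideM sz mulr0 addr0; exact/esym/slide_id.
  move: (f - _) H => g; move: g; apply: in_ideal_ind.
  - by rewrite -mpolyC0 slideC; apply: in_ideal0.
  - by move=> a b; rewrite slideD; apply: in_idealD.
  move=> a b; rewrite -[X in _ \in X]/(behead (powers ((ez, 1%N) :: pts q1))) powers_pts.
  rewrite /= -map_comp => /mapP[[[t z] c] pq ->] /=.
  rewrite slideM; apply: in_idealMl.
  have -> j : slide u (linform ez) (linform (pt (t, z0)) ^+ j) = linform (pt (t, z0)) ^+ j.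
    by elim: j => [|j IH]; rewrite ?expr0 ?slideC // exprS slideM slide_pt IH.
  have -> : linform (pt (t, z0)) = linform (pt (t, z)) + (z0 - z) *: linform ez.
    by rewrite !linform_pt scalerBl; ring.
  have [e|ne] /= := eqVneq z z0.
    by rewrite e subrr scale0r addr0 muln0 addn0 -e; exact: (in_ideal_pt (ez, k.+1) pq).
  rewrite muln1; apply: in_ideal_exprD; first exact: (in_ideal_pt (ez, k.+1) pq).
  by rewrite -mul_mpolyC exprMn; apply: in_idealMl.
have -> // : lower u ((ez, k.+1) :: pts q) =
    (ez, k) :: pts [seq (p.1, p.2 - (p.1.2 != z0))%N | p <- q].
rewrite /lower /= ev_mkform !mul0r mulr1 !add0r oner_eq0 subn1; congr cons.
rewrite /pts -!map_comp; apply: eq_map => p' /=.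
by rewrite ev_mkform mulr1 mulr0 mul1r addr0 addrC subr_eq0.
Qed.

End Degeneration.

(** * Dimension counts *)

Section DimensionCount.
Variable K : fieldType.
Notation R := {mpoly K[3]}.
Notation form := ('I_3 -> K).
Notation H d := (dhomog 3 K d).
Implicit Types (f g h F : R) (s : seq (form * nat)) (r : seq (R * nat)).

Definition hd (e : nat) : nat := 'C(e + 2, 2).

Lemma dimH d : \dim {: H d} = hd d.
Proof.
by rewrite dimvf /dim /= /hd -[RHS]bin_sub ?leq_addl // addnK.
Qed.

Definition toH d f : H d := DHomog (pihomogP mdeg d f).

Lemma toH_is_linear d : linear (toH d).
Proof. by move=> c f g; apply/val_inj; rewrite /= linearP. Qed.

HB.instance Definition _ d :=
  GRing.isLinear.Build K R (H d) _ (toH d) (toH_is_linear d).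

Lemma toHK d f : f \is d.-homog -> val (toH d f) = f.
Proof. exact: pihomog_dE. Qed.

Lemma valH d (x : H d) : toH d (val x) = x.
Proof. by apply/val_inj; rewrite toHK //; apply: dhomog_is_dhomog. Qed.

(** Projecting to degree [d] makes the map total and linear. It is multiplication by [F] only when
    [F] has degree [c] and [c <= d], hence the guards on the degree in [mulHomE] and [gen_space]. *)
Definition mulH c d F (x : H (d - c)) : H d := toH d (F * val x).

Lemma mulH_is_linear c d F : linear (@mulH c d F).
Proof.
move=> a x y; rewrite /mulH linearP /= mulrDr -scalerAr.
by rewrite linearP.
Qed.

HB.instance Definition _ c d F :=
  GRing.isLinear.Build K (H (d - c)) (H d) _ (@mulH c d F) (@mulH_is_linear c d F).

Definition mulHom c d F : 'Hom(H (d - c), H d) := linfun (@mulH c d F).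

Lemma mulHomE c d F (x : H (d - c)) : F \is c.-homog -> (c <= d)%N ->
  val (mulHom c d F x) = F * val x.
Proof.
move=> hF le; rewrite lfunE /= pihomog_dE // -{2}(subnKC le).
by apply: dhomogM => //; apply: dhomog_is_dhomog.
Qed.

Definition gen_space r d : {vspace H d} :=
  (\sum_(p <- r | (p.2 <= d)%N) limg (mulHom p.2 d p.1))%VS.

Lemma gen_space_cons p r d : gen_space (p :: r) d =
  if (p.2 <= d)%N then (limg (mulHom p.2 d p.1) + gen_space r d)%VS
  else gen_space r d.
Proof. by rewrite /gen_space big_cons. Qed.

Lemma mem_gen_space r d f : homog_sys r -> f \is d.-homog ->
  in_ideal (unzip1 r) f <-> toH d f \in gen_space r d.
Proof.
elim: r f => [|[F c] r IH] f.
  move=> _ hf; rewrite in_ideal_nil /gen_space big_nil memv0; split.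
    by move=> ->; rewrite linear0.
  by move=> /eqP e; rewrite -(toHK hf) e.
case/andP=> /= hF hr hf; rewrite gen_space_cons /=; split.
  case/(in_ideal_cons_homog hr hF hf)=> h; rewrite /deg_rep.
  case: ifP => [le hh|lt /eqP ->] hin; last first.
    by move: hin; rewrite mul0r subr0 => /IH; apply.
  have e : toH d (h * F) = mulHom c d F (toH _ h).
    by apply/val_inj; rewrite mulHomE // !toHK // 1?mulrC // -(subnKC le) dhomogM.
  have -> : toH d f = mulHom c d F (toH _ h) + toH d (f - h * F).
    by rewrite -e -[in LHS](subrK (h * F) f) linearD addrC.
  rewrite memv_add ?memv_img ?memvf //.
  apply/IH => //; apply: rpredB => //.
  by rewrite -(subnK le) dhomogM.
case: ifP => [le|_].
  case/memv_addP=> x /memv_imgP[h _ ->] [y hy e]; apply/in_ideal_cons.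
  exists (val h); have : f = F * val h + val y.
    by rewrite -(toHK hf) e /= -mulHomE.
  move=> ->; rewrite mulrC addrC addKr.
  by apply/(IH _ hr); rewrite ?valH //; apply: dhomog_is_dhomog.
by move/(IH _ hr hf) => h; apply/in_ideal_cons; exists 0; rewrite mul0r subr0.
Qed.

Lemma full_dim r d : homog_sys r ->
  full (unzip1 r) d <-> \dim (gen_space r d) = hd d.
Proof.
move=> hr; split=> [hf|e f hf].
  rewrite -dimH; congr (\dim _); apply/vspaceP => x; rewrite memvf.
  rewrite -(valH x); apply/mem_gen_space => //; first exact: dhomog_is_dhomog.
  by apply: hf; apply: dhomog_is_dhomog.
apply/(mem_gen_space hr hf); suff -> : gen_space r d = fullv by apply: memvf.
by apply/eqP; rewrite eqEdim subvf dimH e /=.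
Qed.

(** [phi] maps the preimage of [W] onto the intersection of [W] with the image, with all of the
    kernel of [phi] as kernel. For multiplication by a form, this preimage is a graded piece of a
    colon ideal. *)
Lemma dim_preim (U V : vectType K) (phi : 'Hom(U, V)) (W : {vspace V}) :
  (\dim (limg phi + W) + \dim (phi @^-1: W) = \dim W + \dim {: U})%N.
Proof.
have e1 := dimv_sum_cap (limg phi) W.
have e2 := limg_ker_dim phi fullv; have e3 := limg_ker_dim phi (phi @^-1: W).
have e4 : (phi @: (phi @^-1: W) = limg phi :&: W)%VS by rewrite -lpreim_cap_limg lpreimK ?capvSr // capvC.
have e5 : ((phi @^-1: W) :&: lker phi = lker phi)%VS.
  by apply/capv_idPr; rewrite -lpreim0 lpreimS ?sub0v.
rewrite e4 e5 in e3; rewrite capfv in e2; lia.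
Qed.

Definition hd_principal k e : nat := if (k <= e)%N then hd (e - k) else 0.

Lemma dim_principal F k e : F \is k.-homog -> F != 0 ->
  \dim (gen_space [:: (F, k)] e) = hd_principal k e.
Proof.
move=> hF nF; rewrite gen_space_cons /= /hd_principal /gen_space big_nil.
case: ifP => [le|_]; last exact: dimv0.
rewrite addv0 -dimH; have := limg_ker_dim (mulHom k e F) fullv.
suff -> : lker (mulHom k e F) = 0%VS by rewrite capv0 dimv0 add0n.
apply/eqP; rewrite -subv0; apply/subvP => x; rewrite memv_ker memv0.
move=> /eqP h0; have := mulHomE x hF le; rewrite h0 /= => /esym/eqP.
by rewrite mulf_eq0 (negbTE nF) /= => e0; apply/eqP/val_inj/eqP.
Qed.

(* Dimension of the component of [R / (M ^ k)] in degree [d - c]. *)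
Definition weight k d c : nat :=
  if (c <= d)%N then (hd (d - c) - hd_principal k (d - c))%N else 0.

Lemma hd_principal_le k e : (hd_principal k e <= hd e)%N.
Proof.
rewrite /hd_principal; case: ifP => // le; apply: leq_bin2l; lia.
Qed.

Lemma homog_sys_rcons r p :
  homog_sys (rcons r p) = (p.1 \is p.2.-homog) && homog_sys r.
Proof. by rewrite /homog_sys all_rcons. Qed.

Lemma principal_sub_colon P k r F c d :
  homog_sys (rcons r (P, k)) -> F \is c.-homog -> (c <= d)%N ->
  (gen_space [:: (P, k)] (d - c) <=
   mulHom c d F @^-1: gen_space (rcons r (P, k)) d)%VS.
Proof.
move=> hr hF le; have := hr; rewrite homog_sys_rcons => /andP[/= hP _].
apply/subvP => x; rewrite -{1}(valH x) -memv_preim => /mem_gen_space.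
case/(_ _ _)/in_ideal1 => [||h e]; rewrite /= ?andbT //; first exact: dhomog_is_dhomog.
rewrite -(valH (mulHom _ _ _ _)); apply/mem_gen_space => //.
  exact: dhomog_is_dhomog.
rewrite mulHomE // e; do 2 apply: in_idealMl; apply: in_ideal_gen.
by rewrite /unzip1 map_rcons mem_rcons inE eqxx.
Qed.

(** A generator of degree [c] adds at most the dimension of [R/(P)]_(d-c), since its products with
    multiples of [P] are already present. *)
Lemma dim_gen_space_le P k r d :
  homog_sys (rcons r (P, k)) -> P != 0 ->
  (\dim (gen_space (rcons r (P, k)) d) <=
   \sum_(p <- r) weight k d p.2 + hd_principal k d)%N.
Proof.
move=> hr nP; have := hr; rewrite homog_sys_rcons => /andP[/= hP _].
elim: r hr => [|[F c] r IH]; first by rewrite big_nil add0n dim_principal.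
case/andP=> /= hF hr; rewrite gen_space_cons big_cons {1}/weight /=.
case: ifP => [le|_]; last by rewrite add0n; apply: IH.
have /dimvS := principal_sub_colon hr hF le; rewrite dim_principal //.
have := dim_preim (mulHom c d F) (gen_space (rcons r (P, k)) d); rewrite dimH.
have := IH hr; set S := (\sum_(p <- r) _)%N; move: (\dim _) (\dim (mulHom _ _ _ @^-1: _))%VS (\dim (limg _ + _))%VS (hd_principal k (d - c)) (hd_principal _ _) (hd _); lia.
Qed.

(* If the generators fill degree [d] and the dimensions add up, then there is
   no room for a relation other than the trivial ones. *)
Lemma full_independent P k r1 r2 F c d g :
  let r := r1 ++ (F, c) :: r2 in
  homog_sys (rcons r (P, k)) -> P != 0 ->
  full (unzip1 (rcons r (P, k))) d ->
  (\sum_(p <- r) weight k d p.2 + hd_principal k d <= hd d)%N ->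
  deg_rep c d g -> in_ideal (unzip1 (rcons (r1 ++ r2) (P, k))) (F * g) ->
  in_ideal [:: P] g.
Proof.
move=> r hr nP hfull; rewrite /r big_cat big_cons /= => hw hg hin.
have hperm : perm_eq (rcons r (P, k)) ((F, c) :: rcons (r1 ++ r2) (P, k)).
  by rewrite /r -!cats1 -!catA; apply/permPl/(perm_catCA r1 [:: (F, c)]).
have hr2 : homog_sys ((F, c) :: rcons (r1 ++ r2) (P, k)).
  by rewrite /homog_sys -(perm_all _ hperm).
have hF : F \is c.-homog by case/andP: hr2.
have hr' : homog_sys (rcons (r1 ++ r2) (P, k)) by case/andP: hr2.
have := hr'; rewrite homog_sys_rcons => /andP[/= hP _].
move: hg; rewrite /deg_rep; case: (leqP c d) => [le|lt /eqP->]; last first.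
  by apply: in_ideal0.
have ew : weight k d c = (hd (d - c) - hd_principal k (d - c))%N by rewrite /weight le.
move=> hg.
have : full (unzip1 ((F, c) :: rcons (r1 ++ r2) (P, k))) d.
  move=> f /hfull; apply: in_ideal_sub => x.
  by rewrite (perm_mem (perm_map _ hperm)).
move/(full_dim d hr2).
rewrite gen_space_cons le /= => e1.
have sub := principal_sub_colon hr' hF le.
have := dim_preim (mulHom c d F) (gen_space (rcons (r1 ++ r2) (P, k)) d).
rewrite dimH e1 => e2.
have := dim_gen_space_le d hr' nP; rewrite big_cat /= => e3.
have := hd_principal_le k (d - c) => e4.
(* The colon space contains the multiples of [P]. Since the whole system fills degree [d] and the
   other generators span at most their weights, the colon space has no room to be larger. *)
have /eqP e5 : gen_space [:: (P, k)] (d - c) ==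
    (mulHom c d F @^-1: gen_space (rcons (r1 ++ r2) (P, k)) d)%VS.
  rewrite eqEdim sub dim_principal //=; move: hw e2 e3; rewrite ew.
  set S1 := (\sum_(p <- r1) _)%N; set S2 := (\sum_(p <- r2) _)%N.
  move: e4; move: (\dim _) (\dim (gen_space _ _)) (hd_principal k (d - c))
    (hd_principal k d) (hd d) (hd _); lia.
have : toH (d - c) g \in gen_space [:: (P, k)] (d - c).
  rewrite e5 -memv_preim -(valH (mulHom _ _ _ _)).
  apply/mem_gen_space => //; first exact: dhomog_is_dhomog.
  by rewrite mulHomE // toHK.
by move/mem_gen_space => hgen; apply: hgen => //; rewrite /= hP.
Qed.

End DimensionCount.

(** * Zariski openness *)

Section Openness.
Import VectorInternalTheory.
Variables (K : fieldType) (n : nat).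
Notation R := {mpoly K[3]}.
Notation H d := (dhomog 3 K d).
Notation V := ('I_n -> K).
Implicit Types (P Q : V -> Prop) (F G : V -> R).

(** A local form of openness: one special point satisfying an open condition makes the condition
    general. *)
Definition zopen P := forall v0, P v0 ->
  exists f : {mpoly K[n]}, f.@[v0] != 0 /\ forall v, f.@[v] != 0 -> P v.

Lemma zopen_general P v0 : zopen P -> P v0 -> general P.
Proof.
move=> oP /oP[f [nf hf]]; exists f; split=> //.
by apply: contraNneq nf => ->; rewrite meval0.
Qed.

Lemma generalW P Q : (forall v, P v -> Q v) -> general P -> general Q.
Proof. by move=> PQ [f [nf hf]]; exists f; split=> // v /hf /PQ. Qed.

Lemma generalT P : (forall v, P v) -> general P.
Proof. by move=> hP; exists 1; split; [apply: oner_neq0 | move=> v _]. Qed.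

Lemma generalI P Q : general P -> general Q -> general (fun v => P v /\ Q v).
Proof.
move=> [f [nf hf]] [g [ng hg]]; exists (f * g); split; first by rewrite mulf_neq0.
by move=> v; rewrite mevalM mulf_eq0 => /norP[/hf ? /hg ?].
Qed.

(** Generality passes to finite intersections, so the degrees and exponents are always bounded
    before they are quantified over. *)
Lemma general_bounded (P : nat -> V -> Prop) N :
  (forall i, (i < N)%N -> general (P i)) ->
  general (fun v => forall i, (i < N)%N -> P i v).
Proof.
elim: N => [|N IH] hP; first exact: generalT.
have [i lt|] := generalI (IH _) (hP N (leqnn _)); first exact/hP/ltnW.
move=> f hf; exists f; case: hf => nf hf; split=> // v /hf [h1 h2] i.
by rewrite ltnS leq_eqVlt => /predU1P[->|/h1].
Qed.

Definition polyfun (g : V -> K) :=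
  exists p : {mpoly K[n]}, forall v, g v = p.@[v].

Lemma polyfun_const c : polyfun (fun=> c).
Proof. by exists c%:MP => v; rewrite mevalC. Qed.

Lemma polyfun_sum (I : Type) (r : seq I) (Q : pred I) (g : I -> V -> K) :
  (forall i, Q i -> polyfun (g i)) ->
  polyfun (fun v => \sum_(i <- r | Q i) g i v).
Proof.
move=> hg; elim: r => [|i r [p hp]].
  by exists 0 => v; rewrite big_nil meval0.
case: (boolP (Q i)) => [qi|/negbTE qi]; last first.
  by exists p => v; rewrite big_cons qi.
have [q hq] := hg i qi; exists (q + p) => v.
by rewrite big_cons qi mevalD hp hq.
Qed.

Lemma polyfun_prod (I : Type) (r : seq I) (g : I -> V -> K) :
  (forall i, polyfun (g i)) -> polyfun (fun v => \prod_(i <- r) g i v).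
Proof.
move=> hg; elim: r => [|i r [p hp]].
  by exists 1 => v; rewrite big_nil meval1.
have [q hq] := hg i; exists (q * p) => v.
by rewrite big_cons mevalM hp hq.
Qed.

Lemma polyfunM g h : polyfun g -> polyfun h -> polyfun (fun v => g v * h v).
Proof. by move=> [p hp] [q hq]; exists (p * q) => v; rewrite mevalM hp hq. Qed.

Lemma polyfun_det m (M : V -> 'M[K]_m) :
  (forall i j, polyfun (fun v => M v i j)) -> polyfun (fun v => \det (M v)).
Proof.
move=> hM; apply: polyfun_sum => s _; apply: polyfunM; first exact: polyfun_const.
by apply: polyfun_prod => i.
Qed.

(** A nonvanishing maximal minor at [v0] is a polynomial in the parameters, and wherever it is
    nonzero the rank is at least the rank at [v0]. *)
Lemma zopen_rank m m' (M : V -> 'M[K]_(m, m')) t :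
  (forall i j, polyfun (fun v => M v i j)) -> zopen (fun v => t <= \rank (M v))%N.
Proof.
move=> hM v0 ht; pose B := rowsub (maxrankfun (M v0)) (M v0).
have fB : row_full B^T by rewrite /row_full mxrank_tr; apply: maxrowsub_free.
have uB := fullrowsub_unit fB.
pose N v := rowsub (fullrankfun fB) (rowsub (maxrankfun (M v0)) (M v))^T.
have [p hp] : polyfun (fun v => \det (N v)).
  apply: polyfun_det => i j; have [q hq] := hM (maxrankfun (M v0) j) (fullrankfun fB i).
  by exists q => v; rewrite !mxE hq.
exists p; split; first by rewrite -hp -unitfE -unitmxE.
move=> v; rewrite -hp -unitfE -unitmxE => uN; apply: leq_trans ht _.
have rN := mxrank_unit uN.
rewrite -{1}rN; apply: leq_trans (mxrankS (rowsub_sub _ _)) _.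
by rewrite mxrank_tr; apply/mxrankS/rowsub_sub.
Qed.

Definition polyfam F := exists s : seq ({mpoly K[n]} * R),
  forall v, F v = \sum_(p <- s) p.1.@[v] *: p.2.

Lemma polyfamM F G : polyfam F -> polyfam G -> polyfam (fun v => F v * G v).
Proof.
move=> [s hs] [t ht]; exists [seq (p.1 * q.1, p.2 * q.2) | p <- s, q <- t] => v.
rewrite hs ht big_flatten big_map big_distrl /=; apply: eq_bigr => p _.
rewrite big_map big_distrr; apply: eq_bigr => q _ /=.
by rewrite mevalM -scalerAl -scalerAr scalerA.
Qed.

Lemma polyfam_const f : polyfam (fun=> f).
Proof. by exists [:: (1, f)] => v; rewrite big_seq1 meval1 scale1r. Qed.

Lemma polyfamX F k : polyfam F -> polyfam (fun v => F v ^+ k).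
Proof.
move=> hF; elim: k => [|k IH]; first exact: polyfam_const.
by case: (polyfamM hF IH) => s hs; exists s => v; rewrite exprS hs.
Qed.

Lemma polyfam_linform (c : V -> 'I_3 -> K) :
  (forall i, polyfun (fun v => c v i)) -> polyfam (fun v => linform (c v)).
Proof.
move=> hc; have [p0 h0] := hc 0; have [p1 h1] := hc 1.
have [p2 h2] := hc (Ordinal (isT : 2 < 3)%N).
exists [:: (p0, 'X_0); (p1, 'X_1); (p2, 'X_(Ordinal (isT : 2 < 3)%N))] => v.
rewrite !big_cons big_nil /= -h0 -h1 -h2 /linform !big_ord_recl big_ord0.
by congr (_ + (_ *: 'X_ _ + (_ *: 'X_ _ + _))); try congr (c v _); apply/val_inj.
Qed.

Lemma polyfam_linear (phi : {scalar R}) F :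
  polyfam F -> polyfun (fun v => phi (F v)).
Proof.
case=> s hs; have [p hp] : polyfun (fun v => \sum_(p <- s) p.1.@[v] * phi p.2).
  apply: polyfun_sum => -[p f] _; apply: polyfunM; last exact: polyfun_const.
  by exists p.
by exists p => v; rewrite -hp hs linear_sum; apply: eq_bigr => q _; rewrite linearZ.
Qed.

Definition at_pt (s : seq ((V -> R) * nat)) v : seq (R * nat) :=
  [seq (p.1 v, p.2) | p <- s].

Fixpoint all_polyfam (s : seq ((V -> R) * nat)) : Prop :=
  if s is p :: s' then polyfam p.1 /\ all_polyfam s' else True.

(** A spanning list of [gen_space] whose length is the same for all parameter values, so that its
    coordinates form a matrix with polynomial entries. *)
Definition gen_list (r : seq (R * nat)) d : seq (H d) :=
  flatten [seq if (p.2 <= d)%N then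
                 [seq mulHom p.2 d p.1 b | b <- vbasis {: H (d - p.2)}]
               else [::] | p <- r].

Lemma span_gen_list r d : <<gen_list r d>>%VS = gen_space r d.
Proof.
elim: r => [|[F c] r IH]; first by rewrite span_nil /gen_space big_nil.
rewrite gen_space_cons /gen_list /= span_cat -/(gen_list r d) IH.
case: ifP => _; last by rewrite span_nil add0v.
by rewrite -limg_span (span_basis (vbasisP _)).
Qed.

Lemma dim_span d (X : seq (H d)) m : size X = m ->
  \dim <<X>> = \rank (\matrix_(i < m) v2r X`_i).
Proof.
move=> <-; have -> : <<X>>%VS = mx2vs (b2mx (in_tuple X)).
  by rewrite /span unlock_with.
rewrite /dimv mx2vsK; congr (\rank _).
by apply/row_matrixP => i; rewrite !rowK (tnth_nth 0).
Qed.

Lemma gen_list_poly s d : all_polyfam s -> exists m, forall v,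
  size (gen_list (at_pt s v) d) = m.
Proof.
elim: s => [|[F c] s IH] /=; first by exists 0%N.
case=> _ /IH[m hm].
exists ((if (c <= d)%N then size (vbasis {: H (d - c)}) else 0) + m)%N => v.
rewrite /gen_list /= size_cat -/(gen_list _ d) hm.
by case: ifP => _ //; rewrite size_map.
Qed.

Lemma gen_list_entry s d i j : all_polyfam s ->
  polyfun (fun v => v2r (gen_list (at_pt s v) d)`_i 0 j).
Proof.
elim: s i => [|[F c] s IH] i /=.
  by move=> _; exists 0 => v; rewrite nth_nil linear0 mxE meval0.
case=> hF hs; rewrite /gen_list /=.
set B := vbasis _; pose m := if (c <= d)%N then size B else 0%N.
have sz v : size (if (c <= d)%N then [seq mulHom c d (F v) b | b <- B] else [::]) = m.
  by rewrite /m; case: ifP => _ //; rewrite size_map.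
have [lt|ge] := ltnP i m; last first.
  have [p hp] := IH (i - m)%N hs; exists p => v.
  by rewrite nth_cat sz ltnNge ge /= -hp.
move: lt sz; rewrite /m; case: ifP => // le lt sz.
pose phi f : K := v2r (toH d (f * val B`_i)) 0 j.
have lphi : scalar phi.
  by move=> a f g; rewrite /phi mulrDl -scalerAl !linearP !mxE.
pose phiL : {scalar R} := HB.pack phi (GRing.isLinear.Build _ _ _ _ phi lphi).
have [p hp] := polyfam_linear phiL hF; exists p => v; rewrite -hp.
by rewrite nth_cat sz lt (nth_map 0) // lfunE.
Qed.

Lemma zopen_dim s d t : all_polyfam s ->
  zopen (fun v => t <= \dim (gen_space (at_pt s v) d))%N.
Proof.
move=> hs; have [m hm] := gen_list_poly d hs.
have := @zopen_rank m _ (fun v => \matrix_(i < m) v2r (gen_list (at_pt s v) d)`_i) t.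
move=> H v0 h0.
case: (H _ v0) => [i j||f [nf hf]].
- have [p hp] := @gen_list_entry s d i j hs; exists p => v; by rewrite mxE hp.
- by rewrite -dim_span // span_gen_list.
by exists f; split=> // v /hf; rewrite -dim_span // span_gen_list.
Qed.

End Openness.

(** * Systems in special position *)

Section Levels.
Local Open Scope nat_scope.

(** Greedy choice: each element goes to the first level whose quota is not yet met, and surplus
    elements go to the last level of their kind. *)
Lemma level_assignment (P Q : pred nat) (cs : seq nat) a0 a1 b0 b1 b2 :
  (forall c, P c -> ~~ Q c) ->
  a0 + a1 <= count P cs -> b0 + b1 + b2 <= count Q cs ->
  exists l : seq (nat * nat),
    [/\ unzip1 l = cs,
        a0 <= count (fun x => P x.1 && (x.2 == 0)) l /\
        a1 <= count (fun x => P x.1 && (x.2 == 1)) l,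
        b0 <= count (fun x => Q x.1 && (x.2 == 0)) l,
        b1 <= count (fun x => Q x.1 && (x.2 == 1)) l &
        b2 <= count (fun x => Q x.1 && (x.2 == 2)) l].
Proof.
move=> PQ; elim: cs a0 a1 b0 b1 b2 => [|c cs IH] a0 a1 b0 b1 b2 /=.
  by move=> ha hb; exists [::] => /=; split=> //; lia.
move=> ha hb.
pose z := if P c then (if a0 == 0 then 1 else 0)
          else if b0 == 0 then (if b1 == 0 then 2 else 1) else 0.
have [||l [e [h1 h2] h3 h4 h5]] := IH (a0 - (P c && (z == 0)))
  (a1 - (P c && (z == 1))) (b0 - (Q c && (z == 0)))
  (b1 - (Q c && (z == 1))) (b2 - (Q c && (z == 2))).
- by rewrite /z; case: (P c) ha => /= ha; have [e|e] := eqVneq a0 0 => /=; lia.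
- have := PQ c; rewrite /z; case: (P c) => /= [/(_ isT)/negbTE nq|_].
    by rewrite nq /= in hb *; lia.
  by case: (Q c) hb => /= hb; have [e|e] := eqVneq b0 0;
    have [e'|e'] := eqVneq b1 0 => /=; lia.
clearbody z; exists ((c, z) :: l); rewrite /= e; split=> //; [split| | |].
all: by rewrite -leq_subLR.
Qed.

End Levels.

Section SpecialPosition.
Variable K : fieldType.
Hypothesis charK : [pchar K] =i pred0.
Implicit Types (l : seq (nat * nat)) (cs : seq nat) (d k : nat).

Lemma natr_inj (i j : nat) : (i%:R == j%:R :> K) = (i == j).
Proof.
wlog le : i j / (i <= j)%N => [H|].
  by case: (leqP i j) => [/H //|/ltnW/H]; rewrite eq_sym => ->; rewrite eq_sym.
rewrite -(subnKC le) natrD -{1}[i%:R]addr0 (inj_eq (addrI _)) eq_sym.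
have /pcharf0P -> := charK; lia.
Qed.

(* The [i]-th form is [x + i y + zeta z]: the level [zeta] (the second component
   of [nth l i]) selects one of the lines removed by [full_level]. *)
Definition config l : seq (K * K * nat) :=
  [seq ((i%:R, (nth (0, 0) l i).2%:R), (nth (0, 0) l i).1)
     | i <- iota 0 (size l)]%N.

Lemma config_uniq l : uniq [seq p.1.1 | p <- config l].
Proof.
rewrite -map_comp map_inj_in_uniq ?iota_uniq // => i j _ _ /eqP /=.
by rewrite natr_inj => /eqP.
Qed.

Lemma config_sum l (h : nat -> K -> nat) :
  (\sum_(p <- config l) h p.2 p.1.2 = \sum_(x <- l) h x.1 x.2%:R)%N.
Proof.
by rewrite big_map [RHS](big_nth (0, 0)%N) /index_iota subn0.
Qed.

Lemma config_lower l z0 :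
  [seq (p.1, p.2 - (p.1.2 != z0%:R))%N | p <- config l] =
  config [seq (x.1 - (x.2 != z0), x.2)%N | x <- l].
Proof.
rewrite /config size_map -map_comp; apply/eq_in_map => i.
rewrite mem_iota /= add0n => lt.
by rewrite (nth_map (0, 0)%N) //= natr_inj.
Qed.

Lemma full_config_level l (z0 k d : nat) :
  (d < \sum_(x <- l) (d.+1 - (x.1 + k * (x.2 != z0))))%N ->
  (d = 0%N \/ full (powers ((ez K, k) ::
     pts (config [seq (x.1 - (x.2 != z0), x.2)%N | x <- l]))) d.-1) ->
  full (powers ((ez K, k.+1) :: pts (config l))) d.
Proof.
move=> hs hf; apply: (@full_level _ charK _ z0%:R); first exact: config_uniq.
  rewrite (config_sum l (fun c z => d.+1 - (c + k * (z != z0%:R)))%N).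
  by under eq_bigr do rewrite natr_inj.
by rewrite config_lower.
Qed.

Lemma full_config1 l d :
  (d < \sum_(x <- l) (d.+1 - x.1))%N ->
  full (powers ((ez K, 1%N) :: pts (config l))) d.
Proof.
move=> hs; apply: (full_binary charK) => //; first exact: config_uniq.
by rewrite (config_sum l (fun c z => d.+1 - c)%N).
Qed.

(** Level 0 is removed in degree [d], which leaves a binary problem in degree d - 1; the second
    inequality is the binary count there. *)
Lemma full_config2 l d :
  (d < \sum_(x <- l) (d.+1 - (x.1 + (x.2 != 0))))%N ->
  (d <= \sum_(x <- l) (d - (x.1 - (x.2 != 0))))%N ->
  full (powers ((ez K, 2) :: pts (config l))) d.
Proof.
move=> h0 h1; apply: (@full_config_level _ 0).
  by under eq_bigr do rewrite mul1n.
case: d h0 h1 => [|d] h0 h1; [by left | right].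
by apply: full_config1; rewrite big_map.
Qed.

(** Levels 0 and 1 are removed in degrees d and d - 1, and a binary problem in degree d - 2 remains.
    Each inequality is the count of its stage, with the exponents lowered by the earlier
    removals. *)
Lemma full_config3 l d :
  (d < \sum_(x <- l) (d.+1 - (x.1 + 2 * (x.2 != 0))))%N ->
  (d <= \sum_(x <- l) (d - (x.1 - (x.2 != 0) + (x.2 != 1))))%N ->
  (d.-1 <= \sum_(x <- l) (d.-1 - (x.1 - (x.2 != 0) - (x.2 != 1))))%N ->
  full (powers ((ez K, 3) :: pts (config l))) d.
Proof.
move=> h0 h1 h2; apply: (@full_config_level _ 0) => //.
case: d h0 h1 h2 => [|d] h0 h1 h2; [by left | right].
apply: (@full_config_level _ 1).
  by rewrite big_map; under eq_bigr do rewrite mul1n.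
case: d h0 h1 h2 => [|d] h0 h1 h2; [by left | right].
by apply: full_config1; rewrite !big_map.
Qed.

Definition fills k cs d := exists2 l, unzip1 l = cs &
  full (powers ((ez K, k) :: pts (config l))) d.

Lemma sum_count (T : Type) (s : seq T) (P : pred T) :
  (\sum_(x <- s) P x = count P s)%N.
Proof. by elim: s => [|x s IH]; rewrite ?big_nil // big_cons IH. Qed.

Lemma fills1 cs d : (d < \sum_(c <- cs) (d.+1 - c))%N -> fills 1 cs d.
Proof.
move=> h; exists [seq (c, 0%N) | c <- cs].
  by rewrite /unzip1 -map_comp map_id.
by apply: full_config1; rewrite big_map.
Qed.

(* A generator of degree [c] imposes a point of multiplicity [d + 1 - c] on the
   inverse system in degree [d]; the points have to be distributed over the
   levels so that each level contains enough of them. *)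
Lemma fills2 cs d : all (leq 1) cs ->
  (\sum_(c <- cs) (d - c) <= d)%N ->
  (2 * d < 2 * \sum_(c <- cs) (d - c) + count (fun c => c <= d) cs)%N ->
  fills 2 cs d.
Proof.
set E := (\sum_(c <- cs) _)%N => pos hE hn.
(* Any placement supplies [E] at both stages, which require [d.+1] and [d]; an exponent at most [d]
   adds one at the stage of its own level. *)
have [] := @level_assignment pred0 (fun c => c <= d)%N cs 0 0 (d.+1 - E) (d - E) 0 => //.
  by rewrite addn0; lia.
move=> l [el _ /= h0 h1 _]; exists l => //.
have eE : E = (\sum_(x <- l) (d - x.1))%N by rewrite /E -el big_map.
have posl x : x \in l -> (0 < x.1)%N.
  by move=> xl; apply: (allP pos); rewrite -el; apply: map_f.
apply: full_config2.
  apply: (@leq_trans (\sum_(x <- l) ((d - x.1) + ((x.1 <= d) && (x.2 == 0)))))%N.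
    by rewrite big_split /= -eE sum_count; apply: leq_trans (leq_add (leqnn E) h0); lia.
  by apply: leq_sum => x _; lia.
apply: (@leq_trans (\sum_(x <- l) ((d - x.1) + ((x.1 <= d) && (x.2 == 1)))))%N.
  by rewrite big_split /= -eE sum_count; apply: leq_trans (leq_add (leqnn E) h1); lia.
by rewrite big_seq [leqRHS]big_seq; apply: leq_sum => -[c z] /posl /=; lia.
Qed.

(** Beyond the share [E] common to the three stages, an exponent below [d] acts as a double point:
    worth 2 on its line, and at least 1 at the last stage wherever it lies. An exponent equal to [d]
    acts as a simple point. The numbers a and b prescribe how many of each kind go on each level. *)
Lemma fills3 cs d a0 a1 b0 b1 b2 : all (leq 1) cs ->
  let E := (\sum_(c <- cs) (d.-1 - c))%N in
  (a0 + a1 <= count (fun c => c < d) cs)%N ->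
  (b0 + b1 + b2 <= count (fun c => c == d) cs)%N ->
  (d < E + 2 * a0 + b0)%N -> (d <= E + 2 * a1 + b1)%N ->
  (d.-1 <= E + count (fun c => c < d) cs + b2)%N ->
  fills 3 cs d.
Proof.
move=> pos; set E := (\sum_(c <- cs) _)%N => /= ha hb hd0 hd1 hd2.
have [] := @level_assignment (fun c => c < d)%N (fun c => c == d) cs a0 a1 b0 b1 b2.
- by move=> c; lia.
- by [].
- by [].
move=> l [el [/= h0 h1] /= h2 h3 h4]; exists l => //.
have eE : E = (\sum_(x <- l) (d.-1 - x.1))%N by rewrite /E -el big_map.
have en : count (fun c => c < d)%N cs = count (fun x => x.1 < d)%N l.
  by rewrite -el count_map.
have posl x : x \in l -> (0 < x.1)%N.
  by move=> xl; apply: (allP pos); rewrite -el; apply: map_f.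
apply: full_config3.
- apply: (@leq_trans (\sum_(x <- l) ((d.-1 - x.1) +
    (((x.1 < d) && (x.2 == 0)) + ((x.1 < d) && (x.2 == 0)) + ((x.1 == d) && (x.2 == 0))))))%N.
    rewrite !big_split /= -eE !sum_count.
    by apply: leq_trans (leq_add (leqnn E) (leq_add (leq_add h0 h0) h2)); lia.
  by apply: leq_sum => x _; lia.
- apply: (@leq_trans (\sum_(x <- l) ((d.-1 - x.1) +
    (((x.1 < d) && (x.2 == 1)) + ((x.1 < d) && (x.2 == 1)) + ((x.1 == d) && (x.2 == 1))))))%N.
    rewrite !big_split /= -eE !sum_count.
    by apply: leq_trans (leq_add (leqnn E) (leq_add (leq_add h1 h1) h3)); lia.
  by rewrite big_seq [leqRHS]big_seq; apply: leq_sum => -[c z] /posl /=; lia.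
- case: d @E ha hb hd0 hd1 hd2 h0 h1 h2 h3 h4 eE en => [|[|d]] E // ha hb hd0 hd1 hd2 h0 h1 h2 h3 h4 eE en.
  apply: (@leq_trans (\sum_(x <- l) ((d.+1 - x.1) +
    ((x.1 < d.+2) + ((x.1 == d.+2) && (x.2 == 2))))))%N.
    rewrite !big_split /= -eE !sum_count -en.
    by apply: leq_trans (leq_add (leqnn E) (leq_add (leqnn _) h4)); lia.
  by rewrite big_seq [leqRHS]big_seq; apply: leq_sum => -[c z] /posl /=; lia.
Qed.

Lemma fills3_balanced cs d : all (leq 1) cs ->
  let E := (\sum_(c <- cs) (d.-1 - c))%N in
  let n2 := count (fun c => c < d)%N cs in
  let n1 := count (fun c => c == d) cs in
  (E + n2 < d)%N -> (3 * d <= 3 * E + 3 * n2 + n1)%N -> fills 3 cs d.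
Proof.
(* [D] is the deficit left by [E]. Double points are halved between levels 0 and 1, and simple
   points supply what is missing from [D.+1], [D] and [D.-1]: in all [3 * D - 3 * n2] of them. *)
move=> pos E n2 n1 h h'; pose D := (d - E)%N; pose a0 := n2./2.
apply: (@fills3 cs d a0 (n2 - a0) (D.+1 - 2 * a0) (D - 2 * (n2 - a0)) (D.-1 - n2)) => //;
  rewrite -/E -/n2 -/n1; move: h h'; rewrite /D /a0; lia.
Qed.

(* Without the hypothesis [d \in cs] this can fail when [n2 = d - E] is even: the
   inverse system then contains a double curve, which one extra simple point
   destroys. *)
Lemma fills3_excess cs d : all (leq 1) cs ->
  let E := (\sum_(c <- cs) (d.-1 - c))%N in
  let n2 := count (fun c => c < d)%N cs in
  (E < d)%N -> (d <= E + n2)%N -> d \in cs -> fills 3 cs d.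
Proof.
move=> pos E n2 h h' din; pose D := (d - E)%N.
have hn1 : (0 < count (fun c => c == d) cs)%N.
  by rewrite -has_count; apply/hasP; exists d.
(* The double points cover both levels up to parity: the simple point is wanted on level 0 when [D]
   is even and on level 1 when [D] is odd. *)
pose a0 := uphalf D; pose b := odd D.
apply: (@fills3 cs d a0 (n2 - a0) (~~ b) b 0) => //;
  rewrite -/E -/n2; move: h h' hn1; rewrite /a0 /b /D; lia.
Qed.

End SpecialPosition.

(** * General systems *)

Section LinearFamilies.
Variables (K : fieldType) (n : nat).
Notation form := ('I_3 -> K).
Notation V := ('I_n -> K).
Implicit Types (fs : seq ((V -> form) * nat)).

Definition inst fs (v : V) : seq (form * nat) := [seq (p.1 v, p.2) | p <- fs].

Fixpoint poly_coords fs : Prop :=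
  if fs is p :: fs' then (forall i, polyfun (fun v => p.1 v i)) /\ poly_coords fs'
  else True.

Lemma poly_coords_cat fs1 fs2 :
  poly_coords fs1 -> poly_coords fs2 -> poly_coords (fs1 ++ fs2).
Proof. by elim: fs1 => //= p fs IH [hp /IH h] /h. Qed.

Lemma zopen_dim_inst fs d t : poly_coords fs ->
  zopen (fun v => t <= \dim (gen_space (psys (inst fs v)) d))%N.
Proof.
move=> hfs; pose s := [seq ((fun v => linform (p.1 v) ^+ p.2), p.2) | p <- fs].
have e v : psys (inst fs v) = at_pt s v by rewrite /psys /inst /at_pt -!map_comp.
have hs : all_polyfam s.
  rewrite /s; elim: fs hfs {s e} => //= p fs IH [hp /IH hs]; split=> //.
  exact/polyfamX/polyfam_linform.
move=> v0; rewrite e => /(zopen_dim hs)[f [nf hf]]; exists f; split=> // v /hf.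
by rewrite e.
Qed.

Lemma dim_full s d : (hd d <= \dim (gen_space (psys s) d))%N <->
  full (powers (s : seq (form * nat))) d.
Proof.
rewrite powersE (full_dim d (psys_homog s)); split=> [h|->//].
by apply/eqP; rewrite eqn_leq h -(dimH K) dimvS ?subvf.
Qed.

Lemma zopen_full fs d : poly_coords fs ->
  zopen (fun v => full (powers (inst fs v)) d).
Proof.
move=> hfs v0 /dim_full /(zopen_dim_inst hfs)[f [nf hf]].
by exists f; split=> // v /hf /dim_full.
Qed.

Definition constf (s : seq (form * nat)) : seq ((V -> form) * nat) :=
  [seq ((fun=> p.1), p.2) | p <- s].

Lemma inst_constf s v : inst (constf s) v = s.
Proof. by rewrite /inst /constf -map_comp /= -[RHS]map_id; apply: eq_map => -[]. Qed.

Lemma poly_coords_const s : poly_coords (constf s).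
Proof. by elim: s => //= p s IH; split=> // i; apply: polyfun_const. Qed.

Lemma inst_cat fs1 fs2 v : inst (fs1 ++ fs2) v = inst fs1 v ++ inst fs2 v.
Proof. exact: map_cat. Qed.

End LinearFamilies.

(** * Parametrised forms and the passage from special to general position *)

Section GeneralForms.
Variables (K : fieldType) (S : nat).
Notation form := ('I_3 -> K).
Notation V := ('I_(3 * S) -> K).
Implicit Types (js : seq (nat * nat)) (v : V).

Definition kc v k : form := fun j => coordn v (3 * k + j).

Lemma polyfun_kc k j : polyfun (fun v => kc v k j).
Proof.
rewrite /kc /coordn; case: insub => [i|]; last exact: polyfun_const.
by exists 'X_i => v; rewrite mevalXU.
Qed.

Definition fam v js : seq (form * nat) := [seq (kc v p.1, p.2) | p <- js].
Definition famf js : seq ((V -> form) * nat) := [seq (kc^~ p.1, p.2) | p <- js].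

Lemma inst_famf js v : inst (famf js) v = fam v js.
Proof. by rewrite /inst /famf -map_comp. Qed.

Lemma poly_coords_famf js : poly_coords (famf js).
Proof. by elim: js => //= p js IH; split=> // i; apply: polyfun_kc. Qed.

Definition point_of (A : nat -> form) : V :=
  fun m => A (m %/ 3)%N (inord (m %% 3)).

Lemma kc_point A k j : (k < S)%N -> kc (point_of A) k j = A k j.
Proof.
move=> lt; rewrite /kc /coordn insubT => [|h].
  by have := ltn_ord j; lia.
rewrite /point_of /=; have ltj := ltn_ord j.
have -> : ((3 * k + j) %/ 3 = k)%N by lia.
by congr (A k _); apply/val_inj; rewrite /= inordK; lia.
Qed.

Lemma eq_linform (c c' : form) : c =1 c' -> linform c = linform c'.
Proof. by move=> e; apply: eq_bigr => i _; rewrite e. Qed.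

Lemma general_neq0 k : (k < S)%N -> general (fun v => linform (kc v k) != 0).
Proof.
move=> lt; have [p hp] := polyfun_kc k (Ordinal (isT : 2 < 3)%N).
exists p; split.
  have e := hp (point_of (fun=> ez K)); rewrite kc_point // in e.
  by apply: contra_eq_neq e => ->; rewrite meval0 /ez /mkform /= oner_neq0.
move=> v; rewrite -hp; apply: contraNneq => e.
have := congr1 (mcoeff U_(Ordinal (isT : 2 < 3)%N)) e; rewrite mcoeff0 => <-.
rewrite /linform raddf_sum (bigD1 (Ordinal (isT : 2 < 3)%N)) //= big1.
  by rewrite mcoeffZ mcoeffX eqxx mulr1 addr0.
by move=> i ne; rewrite mcoeffZ mcoeffX eq_mnm1 (negbTE ne) mulr0.
Qed.

(** A parameter point realises the special configuration, and fullness is open. The [e] extra powers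
    of degree [d] are frozen at their special position, so they consume no parameters. *)
Lemma general_full_extra k js iM e d :
  (0 < k)%N -> uniq (iM :: unzip1 js) -> all (gtn S) (iM :: unzip1 js) ->
  fills K k (unzip2 js ++ nseq e d) d ->
  exists2 ext : seq (form * nat), unzip2 ext = nseq e d &
    general (fun v => full (powers (rcons (fam v js ++ ext) (kc v iM, k))) d).
Proof.
move=> k0; rewrite !cons_uniq => /andP[niM uj] /andP[ltM /allP ltj] [l el hl].
have szl : size l = (size js + e)%N.
  by rewrite -(size_map fst) [map _ _]el size_cat size_map size_nseq.
pose q := pts (config K l); have szq : size q = size l by rewrite !size_map size_iota.
have q2 i : (i < size l)%N -> (nth (ez K, 0%N) q i).2 = nth 0%N (unzip2 js ++ nseq e d) i.
  move=> lt; rewrite /q /pts /config -map_comp (nth_map 0%N) ?size_iota //=.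
  by rewrite nth_iota // add0n -el (nth_map (0, 0)%N).
have u2q : unzip2 q = unzip2 js ++ nseq e d.
  apply: (@eq_from_nth _ 0%N); rewrite size_map szq ?size_cat ?size_map ?size_nseq //.
  by move=> i lt; rewrite (nth_map (ez K, 0%N)) ?szq // q2.
exists (drop (size js) q).
  by rewrite /unzip2 map_drop [map _ _]u2q drop_size_cat // size_map.
set ext := drop _ _.
pose A i := if i == iM then ez K else (nth (ez K, 0%N) q (index i (unzip1 js))).1.
pose fs := famf js ++ constf (3 * S) ext ++ famf [:: (iM, k)].
have efs v : inst fs v = rcons (fam v js ++ ext) (kc v iM, k).
  by rewrite /fs !inst_cat !inst_famf inst_constf -cats1 catA.
have /zopen_general H : zopen (fun v => full (powers (inst fs v)) d).
  apply: zopen_full; apply: poly_coords_cat; first exact: poly_coords_famf.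
  apply: poly_coords_cat; [exact: poly_coords_const | exact: poly_coords_famf].
have [|f [nf hf]] := H (point_of A); last first.
  by exists f; split=> // v /hf; rewrite efs.
rewrite efs; apply: full_trans hl => g.
rewrite -[powers (_ :: _)]/(linform (ez K) ^+ k :: powers q) inE => /predU1P[->|gq]; apply: in_ideal_gen.
  rewrite /powers map_rcons mem_rcons inE /=; apply/orP; left.
  by rewrite (eq_linform (fun j => kc_point A j ltM)) /A eqxx.
rewrite /powers map_rcons mem_rcons inE; apply/orP; right.
rewrite map_cat mem_cat; move: gq; rewrite -{1}(cat_take_drop (size js) q).
rewrite /powers map_cat mem_cat => /orP[h|->]; last by rewrite orbT.
apply/orP; left; move: h; set X := map _ _; set Y := map _ _.
suff -> : X = Y by [].
have szX : size X = size js by rewrite !size_map size_take szq szl; case: ltnP; lia.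
apply: (@eq_from_nth _ 0); rewrite szX ?size_map // => i lt.
rewrite /Y /fam -map_comp (nth_map (0, 0)%N) //= /X (nth_map (ez K, 0%N)); last first.
  by have := lt; rewrite -{1}szX size_map.
rewrite nth_take // q2 ?szl; last lia.
rewrite nth_cat size_map lt (nth_map (0, 0)%N) //; congr (_ ^+ _).
set x := nth _ js i; have xin : x.1 \in unzip1 js by apply/map_f/mem_nth.
rewrite (eq_linform (fun j => kc_point A j (ltj _ xin))) /A.
rewrite ifN; last by apply: contraNneq niM => <-.
by rewrite -(nth_map _ 0%N) ?index_uniq ?size_map.
Qed.

End GeneralForms.

Lemma sum_nseq (F : nat -> nat) e d : (\sum_(c <- nseq e d) F c = e * F d)%N.
Proof. by elim: e => [|e IH]; rewrite /= ?big_nil // big_cons IH mulSn. Qed.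

Lemma hdS e : hd e.+1 = (hd e + e.+2)%N.
Proof. by rewrite /hd !addn2 binS bin1. Qed.

Lemma weight_principal k d : hd d = (weight k d 0 + hd_principal k d)%N.
Proof. by rewrite /weight leq0n subn0 subnK // hd_principal_le. Qed.

Lemma weight_diag k d : (0 < k)%N -> weight k d d = 1%N.
Proof. by case: k => // k _; rewrite /weight leqnn subnn. Qed.

Lemma weight1 d c : weight 1 d c = (d.+1 - c)%N.
Proof.
rewrite /weight /hd_principal; case: (leqP c d) => [le|lt]; last lia.
rewrite subSn //; case: (d - c)%N => [|e] //=.
by rewrite subn1 /= hdS; lia.
Qed.

Lemma weight2 d c : weight 2 d c = (2 * (d - c) + (c <= d))%N.
Proof.
rewrite /weight /hd_principal; case: (leqP c d) => [le|lt]; last lia.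
case: (d - c)%N => [|[|e]] //=.
by rewrite subn2 /= !hdS; lia.
Qed.

Lemma weight3 d c : weight 3 d c = (3 * (d.-1 - c) + 3 * (c < d) + (c == d))%N.
Proof.
rewrite /weight /hd_principal; case: (leqP c d) => [le|lt]; last lia.
have := subnK le; case: (d - c)%N => [|[|[|e]]] //=.
- by move=> h; have -> : c = d by []; rewrite eqxx (_ : hd 0 = 1%N) //; lia.
- by move=> h; rewrite (_ : hd 1 = 3%N) //; lia.
- by move=> h; rewrite (_ : hd 2 = 6%N) //; lia.
by rewrite (_ : (e.+3 - 3 = e)%N) ?hdS; lia.
Qed.

(** * Expected dimension of general powers modulo M^k for k at most 3 *)

Section GeneralPosition.
Variables (K : fieldType) (S : nat).
Hypothesis charK : [pchar K] =i pred0.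
Notation form := ('I_3 -> K).
Notation V := ('I_(3 * S) -> K).
Implicit Types (js : seq (nat * nat)) (v : V).

Definition fills_at v iM k js d :=
  full (powers (rcons (fam v js) (kc v iM, k))) d.

(** Modulo M^k the multiples of the generators are linearly independent in degree [d]; even nonzero
    Koszul relations are excluded. *)
Definition indep_at v iM k js d :=
  forall j1 i c j2 (g : {mpoly K[3]}), js = j1 ++ (i, c) :: j2 -> deg_rep c d g ->
  in_ideal (powers (rcons (fam v (j1 ++ j2)) (kc v iM, k)))
    (linform (kc v i) ^+ c * g) ->
  in_ideal [:: linform (kc v iM) ^+ k] g.

Definition admissible iM js :=
  [&& uniq (iM :: unzip1 js), all (gtn S) (iM :: unzip1 js) & all (leq 1) (unzip2 js)].

Lemma general_fills k js iM d : (0 < k)%N -> admissible iM js ->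
  fills K k (unzip2 js) d -> general (fun v => fills_at v iM k js d).
Proof.
move=> k0 /and3P[uj ltj _] h.
have [|[|//] _] := @general_full_extra K S k js iM 0 d k0 uj ltj.
  by rewrite cats0.
by apply: generalW => v; rewrite cats0.
Qed.

Lemma psys_rcons (s : seq (form * nat)) p :
  psys (rcons s p) = rcons (psys s) (linform p.1 ^+ p.2, p.2).
Proof. exact: map_rcons. Qed.

(** Extra powers of degree [d], each of weight one, complete the system to a full one without
    exceeding the available dimension; then [full_independent] applies to each generator of [js]. *)
Lemma general_indep k js iM e d : (0 < k)%N -> admissible iM js ->
  fills K k (unzip2 js ++ nseq e d) d ->
  (\sum_(c <- unzip2 js) weight k d c + e <= weight k d 0)%N ->
  general (fun v => indep_at v iM k js d).
Proof.
move=> k0 /and3P[uj ltj _] h hw.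
have [ext e2 hext] := general_full_extra k0 uj ltj h.
have ltM : (iM < S)%N by case/andP: ltj.
apply: generalW (generalI hext (general_neq0 K ltM)) => v [hf nM].
move=> j1 i c j2 g ejs hg hin.
pose r1 := psys (fam v j1); pose r2 := psys (fam v j2 ++ ext).
pose F := linform (kc v i) ^+ c; pose P := linform (kc v iM) ^+ k.
have er : psys (fam v js ++ ext) = r1 ++ (F, c) :: r2.
  by rewrite ejs /r1 /r2 /psys /fam !map_cat -catA.
have erP : psys (rcons (fam v js ++ ext) (kc v iM, k)) = rcons (r1 ++ (F, c) :: r2) (P, k).
  by rewrite psys_rcons er.
apply: (@full_independent K P k r1 r2 F c d g) => //.
- by rewrite -erP psys_homog.
- by rewrite expf_neq0.
- by rewrite -erP -powersE.
- rewrite -er /psys big_map big_cat /= /fam big_map.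
  have -> : (\sum_(p <- ext) weight k d p.2 = e)%N.
    by rewrite -[LHS](big_map snd xpredT) [map _ _]e2 sum_nseq weight_diag ?muln1.
  by rewrite [leqRHS](weight_principal k) leq_add2r; move: hw; rewrite big_map.
- apply: in_ideal_sub hin => x; rewrite powersE psys_rcons /r1 /r2.
  rewrite /unzip1 !map_rcons !mem_rcons !inE /psys /fam !map_cat !mem_cat.
  by case/or3P=> ->; rewrite ?orbT.
Qed.

Lemma general_forms1 js iM d : admissible iM js ->
  general (fun v => if (\sum_(c <- unzip2 js) (d.+1 - c) <= d)%N
                    then indep_at v iM 1 js d else fills_at v iM 1 js d).
Proof.
move=> hj; case: leqP => h; last by apply: general_fills => //; apply: fills1.
set E := bigop.body _ _ _ in h.
have ew : (\sum_(c <- unzip2 js) weight 1 d c = E)%N.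
  by apply: eq_bigr => c _; rewrite weight1.
apply: (@general_indep _ _ _ (d.+1 - E)) => //.
  by apply: fills1 => //; rewrite big_cat sum_nseq /= -/E; lia.
by rewrite ew weight1; lia.
Qed.

Lemma general_forms2 js iM d : admissible iM js ->
  let E := (\sum_(c <- unzip2 js) (d - c))%N in
  (0 < d)%N -> (E <= d)%N ->
  general (fun v =>
    if (2 * d < 2 * E + count (fun c => c <= d) (unzip2 js))%N
    then fills_at v iM 2 js d else indep_at v iM 2 js d).
Proof.
move=> hj E d0 hE; have /and3P[_ _ pos] := hj.
case: ltnP => h; first by apply: general_fills => //; apply: fills2.
set n := count _ _ in h.
have ew : (\sum_(c <- unzip2 js) weight 2 d c = 2 * E + n)%N.
  rewrite /n /E big_distrr -sum_count -big_split; apply: eq_bigr => c _.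
  by rewrite weight2.
apply: (@general_indep _ _ _ ((2 * d).+1 - (2 * E + n))) => //.
  apply: fills2 => //; rewrite ?all_cat ?pos ?all_nseq /= ?d0 ?orbT //.
    by rewrite big_cat sum_nseq /= -/E subnn; lia.
  by rewrite big_cat sum_nseq count_cat count_nseq /= -/E -/n subnn leqnn; lia.
by rewrite ew weight2; lia.
Qed.

(** The total weight is compared with 3d, the dimension of [R/(M^3)]_d. When it is smaller, padding
    with exponents equal to [d] changes neither [E] nor [n2], so the balanced case still applies. *)
Lemma general_forms3 js iM d : admissible iM js ->
  let E := (\sum_(c <- unzip2 js) (d.-1 - c))%N in
  let n2 := count (fun c => c < d)%N (unzip2 js) in
  let n1 := count (fun c => c == d) (unzip2 js) in
  (E + n2 < d)%N ->
  general (fun v => if (3 * d <= 3 * E + 3 * n2 + n1)%N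
    then fills_at v iM 3 js d else indep_at v iM 3 js d).
Proof.
move=> hj E n2 n1 hE; have /and3P[_ _ pos] := hj.
case: leqP => h; first by apply: general_fills => //; apply: fills3_balanced.
have ew : (\sum_(c <- unzip2 js) weight 3 d c = 3 * E + 3 * n2 + n1)%N.
  rewrite /E /n2 /n1 -!sum_count !big_distrr -!big_split; apply: eq_bigr => c _.
  by rewrite weight3.
have d0 : (0 < d)%N by lia.
apply: (@general_indep _ _ _ (3 * d - (3 * E + 3 * n2 + n1))) => //.
  apply: fills3_balanced => //; rewrite ?all_cat ?pos ?all_nseq /= ?d0 ?orbT //.
  - by rewrite big_cat sum_nseq count_cat count_nseq /= -/E -/n2 ltnn; lia.
  - by rewrite big_cat sum_nseq !count_cat !count_nseq /= -/E -/n2 -/n1 ltnn eqxx; lia.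
by rewrite ew weight3; lia.
Qed.

Lemma general_forms3_excess js iM d : admissible iM js ->
  let E := (\sum_(c <- unzip2 js) (d.-1 - c))%N in
  let n2 := count (fun c => c < d)%N (unzip2 js) in
  (E < d)%N -> (d <= E + n2)%N -> d \in unzip2 js ->
  general (fun v => fills_at v iM 3 js d).
Proof.
move=> hj E n2 h1 h2 h3; have /and3P[_ _ pos] := hj.
by apply: general_fills => //; apply: fills3_excess.
Qed.

End GeneralPosition.

(** * Arithmetic of the number p *)

Section SocleDegree.
Local Open Scope nat_scope.
Implicit Types (cs : seq nat) (j d c b : nat).

Lemma p_condE cs j : p_cond cs j = (\sum_(c <- cs) (j.+1 - c) <= j).
Proof.
rewrite /p_cond big_mkcond /= (eq_big_seq (fun c => j.+1 - c)) // => c _.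
by case: leqP => // lt; lia.
Qed.

Lemma sum_succ cs d :
  \sum_(c <- cs) (d.+1 - c) = \sum_(c <- cs) (d - c) + count (fun c => c <= d) cs.
Proof.
by rewrite -sum_count -big_split; apply: eq_bigr => c _ /=; lia.
Qed.

(** If some exponent is at most [j.+1], the sum drops by at least one along with the degree;
    otherwise the sum for [j] is zero. *)
Lemma p_cond_pred cs j : p_cond cs j.+1 -> p_cond cs j.
Proof.
rewrite !p_condE sum_succ; have [/hasP[c cc le]|/hasPn no _] :=
  boolP (has (fun c => c <= j.+1) cs).
  have : 0 < count (fun c => c <= j.+1) cs by rewrite -has_count; apply/hasP; exists c.
  lia.
by rewrite big_seq big1 // => c /no /=; lia.
Qed.

Lemma p_cond_anti cs i j : i <= j -> p_cond cs j -> p_cond cs i.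
Proof.
move=> /subnK <-; elim: (j - i) => [|k IH] //; rewrite addSn => /p_cond_pred.
exact: IH.
Qed.

(** The qualifying degrees form an initial segment, and two positive exponents keep it below the
    bound in the definition of [p_of]. *)
Lemma leq_p_of cs j : 1 < size cs -> all (leq 1) cs -> (j <= p_of cs) = p_cond cs j.
Proof.
move=> sz pos; have bound i : p_cond cs i -> i < (sumn cs).+1.
  rewrite p_condE; case: cs sz pos => [|c1 [|c2 r]] // _ _; rewrite !big_cons /=.
  lia.
apply/idP/idP => [le|h]; last first.
  exact: (leq_bigmax_cond (F := fun i : 'I_(sumn cs).+1 => i : nat) (Ordinal (bound j h))).
apply: p_cond_anti le _; rewrite /p_of.
have c0 : p_cond cs 0.
  rewrite p_condE big_seq big1 // => c /(allP pos); lia.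
by have [i hi ->] := @eq_bigmax_cond _ [pred i : 'I_(sumn cs).+1 | p_cond cs i]
  (fun i => i : nat) ltac:(by apply/card_gt0P; exists ord0).
Qed.

Lemma p_of_bounds cs (p := p_of cs) : 1 < size cs -> all (leq 1) cs ->
  \sum_(c <- cs) (p.+1 - c) <= p /\ p.+1 < \sum_(c <- cs) (p.+2 - c).
Proof.
move=> sz pos; split; first by rewrite -p_condE -leq_p_of.
by rewrite ltnNge -p_condE -leq_p_of // ltnn.
Qed.

Lemma p_of_rcons_le cs b : 1 < size cs -> all (leq 1) cs -> 0 < b ->
  p_of (rcons cs b) <= p_of cs.
Proof.
move=> sz pos b0; rewrite leq_p_of //.
have : p_cond (rcons cs b) (p_of (rcons cs b)).
  by rewrite -leq_p_of ?size_rcons ?all_rcons ?b0 //; lia.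
rewrite !p_condE -cats1 big_cat /=; lia.
Qed.

Lemma p_of_rcons_top cs : 1 < size cs -> all (leq 1) cs ->
  p_of (rcons cs (p_of cs).+1) = p_of cs.
Proof.
move=> sz pos; apply/eqP; rewrite eqn_leq p_of_rcons_le //.
rewrite leq_p_of ?size_rcons ?all_rcons //; last lia.
have [h _] := p_of_bounds sz pos.
by rewrite p_condE -cats1 big_cat /= big_seq1 subnn addn0.
Qed.

End SocleDegree.

(** * Maximal rank *)

Section GradedMultiplication.
Variable K : fieldType.
Notation R := {mpoly K[3]}.
Implicit Types (f g h F G : R) (r : seq (R * nat)) (c d e j k : nat).

Lemma full_mono (gs : seq R) i j : (i <= j)%N -> full gs i -> full gs j.
Proof.
move=> /subnK <-; elim: (j - i)%N => [|k IH] // /IH {}IH f hf; rewrite [f]mpolyE.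
rewrite big_seq; apply: in_ideal_sum => m hm; rewrite -mul_mpolyC; apply: in_idealMl.
have : mdeg m = (k + i).+1 by have := dhomog_mf hf hm.
case: (pickP (fun l : 'I_3 => (0 < m l)%N)) => [l ml em|no].
  have e : m = ((m - U_(l)) + U_(l))%MM.
    by rewrite submK //; apply/mnm_lepP => l'; rewrite mnm1E; case: eqP => // <-.
  rewrite e mpolyXD; apply: in_idealMr; apply: IH; rewrite dhomogX /=.
  by move: em; rewrite {1}e mdegD mdeg1; lia.
by rewrite mdegE big1 // => l _; have := no l; case: (m l).
Qed.

Lemma deg_rep_shift c d e h G : G \is c.-homog -> (c <= d)%N ->
  deg_rep e (d - c) h -> deg_rep e d (h * G).
Proof.
move=> hG le; rewrite /deg_rep; case: (leqP e (d - c)) => [le'|lt].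
  have -> : (e <= d)%N by lia.
  move=> hh; have -> : (d - e = d - c - e + c)%N by lia.
  exact: dhomogM.
by move=> /eqP ->; rewrite mul0r eqxx dhomog0 if_same.
Qed.

Lemma deg_repB d e f g : deg_rep d e f -> deg_rep d e g -> deg_rep d e (f - g).
Proof.
rewrite /deg_rep; case: ifP => _; first exact: rpredB.
by move=> /eqP-> /eqP->; rewrite subr0.
Qed.

Lemma mult_inj_comp (gs : seq R) F j k m : F \is (1%N).-homog ->
  mult_inj gs (F ^+ m) m j -> mult_inj gs (F ^+ k) k (j - m) ->
  mult_inj gs (F ^+ (m + k)) (m + k) j.
Proof.
move=> hF hm hk f hf; rewrite exprD -mulrA => hin.
have [le|lt] := leqP (m + k) j; last first.
  move: hf; rewrite /deg_rep leqNgt lt /= => /eqP->; exact: in_ideal0.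
have hf' : f \is (j - (m + k)).-homog by move: hf; rewrite /deg_rep le.
have hFk : F ^+ k \is k.-homog by have := dhomogMn k hF; rewrite mul1n.
apply: hk; first by rewrite /deg_rep -subnDA hf'; case: ifP => //; lia.
apply: hm => //; rewrite /deg_rep; have -> : (m <= j)%N by lia.
have -> : (j - m = k + (j - (m + k)))%N by lia.
exact: dhomogM.
Qed.

Lemma mult_inj0 (gs : seq R) F j : mult_inj gs (F ^+ 0) 0 j.
Proof. by move=> f _; rewrite mul1r. Qed.

Lemma mult_inj_pow (gs : seq R) F p k j : F \is (1%N).-homog ->
  (forall d, (d <= p)%N -> mult_inj gs F 1 d) -> (j <= p)%N ->
  mult_inj gs (F ^+ k) k j.
Proof.
move=> hF h; elim: k j => [|k IH] j le; first exact: mult_inj0.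
rewrite -[k.+1]add1n; apply: mult_inj_comp => //; first exact: h.
by apply: IH; lia.
Qed.

(** Multiplications by [F] into degrees d - k + 1, ..., d are surjective, since these degrees all
    exceed [p], and they compose. *)
Lemma full_pow r F p k d : homog_sys r -> F \is (1%N).-homog ->
  (forall i, (p < i)%N -> full (F :: unzip1 r) i) -> (p + k <= d)%N ->
  full (F ^+ k :: unzip1 r) d.
Proof.
move=> hr hF h; elim: k => [|k IH] le f hf.
  by apply/in_ideal_cons; exists f; rewrite mulr1 subrr; apply: in_ideal0.
have hFk : F ^+ k \is k.-homog by have := dhomogMn k hF; rewrite mul1n.
have [|h1] := in_ideal_cons_homog hr hFk hf (IH _ f hf); first lia.
rewrite /deg_rep ifT; last lia.
move=> hh1 e1; have [|h2 _ e2] := in_ideal_cons_homog hr hF hh1 (h _ _ h1 hh1).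
  lia.
apply/in_ideal_cons; exists h2.
have -> : f - h2 * F ^+ k.+1 = (f - h1 * F ^+ k) + F ^+ k * (h1 - h2 * F).
  by rewrite exprS; ring.
by apply: in_idealD => //; apply: in_idealMl.
Qed.

(** A relation F f = G g modulo [r] can be read from both sides. Injectivity of [G] modulo [F] gives
    g = g' F, and then F (f - g' G) = 0 gives f = g' G by injectivity of [F]. *)
Lemma mult_inj_exchange r F G e c j : homog_sys r ->
  F \is e.-homog -> G \is c.-homog ->
  mult_inj (rcons (unzip1 r) F) G c j -> mult_inj (unzip1 r) F e j ->
  mult_inj (rcons (unzip1 r) G) F e j.
Proof.
move=> hr hF hG injG injF f hf; have hFf := deg_repM hF hf.
have cons_rcons g x : in_ideal (rcons (unzip1 r) x) g <-> in_ideal (x :: unzip1 r) g.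
  by split; apply: in_ideal_sub => y; rewrite mem_rcons.
move/cons_rcons/(in_ideal_cons_homog hr hG hFf)=> [g hg eg].
have : in_ideal (rcons (unzip1 r) F) g.
  apply: injG => //; rewrite -[G * g](subrK (F * f)); apply: in_idealD.
    rewrite -opprB [G * g]mulrC; apply: in_idealN; apply: in_ideal_sub eg => y.
    by rewrite mem_rcons inE => ->; rewrite orbT.
  by apply/in_idealMr/in_ideal_gen; rewrite mem_rcons inE eqxx.
have [le|lt] := leqP c j; last first.
  move: hg eg; rewrite /deg_rep leqNgt lt /= => /eqP-> eg _.
  apply/in_ideal_rcons; exists 0; rewrite mul0r subr0; apply: injF => //.
  by move: eg; rewrite mul0r subr0.
have hg' : g \is (j - c).-homog by move: hg; rewrite /deg_rep le.
move/cons_rcons/(in_ideal_cons_homog hr hF hg')=> [g' dg' eg'].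
apply/in_ideal_rcons; exists g'; apply: injF.
  exact: deg_repB hf (deg_rep_shift hG le dg').
have -> : F * (f - g' * G) = (F * f - g * G) + G * (g - g' * F) by ring.
by apply: in_idealD => //; apply: in_idealMl.
Qed.

End GradedMultiplication.

(** * From independence modulo M^k to injectivity *)

Section FromGeneralPosition.
Variables (K : fieldType) (S : nat).
Notation R := {mpoly K[3]}.
Notation V := ('I_(3 * S) -> K).
Implicit Types (js : seq (nat * nat)) (v : V).

(** The generators are peeled off one at a time: in M^k f = g L^c + ..., independence makes g a
    multiple h M^k, and f is replaced by f - h L^c. *)
Lemma indep_mult_inj v iM k js d : linform (kc v iM) != 0 ->
  indep_at v iM k js d ->
  mult_inj (powers (fam v js)) (linform (kc v iM) ^+ k) k d.
Proof.
set M := linform _ => nM hind.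
have hM : M ^+ k \is k.-homog by apply: linformX_homog.
suff H j2 j1 : js = j1 ++ j2 -> mult_inj (powers (fam v j2)) (M ^+ k) k d.
  exact: (H js [::]).
elim: j2 j1 => [|[i c] j2 IH] j1 ejs f hf.
  move/in_ideal_nil/eqP; rewrite mulf_eq0 expf_eq0 (negbTE nM) andbF /=.
  by move/eqP->; apply: in_ideal0.
have hL : linform (kc v i) ^+ c \is c.-homog by apply: linformX_homog.
have hMf := deg_repM hM hf.
rewrite -[powers _]/(linform (kc v i) ^+ c :: powers (fam v j2)) powersE.
move/(in_ideal_cons_homog (psys_homog _) hL hMf) => [g dg eg].
have [h gE dh] : exists2 h, g = h * M ^+ k & deg_rep k d (h * linform (kc v i) ^+ c).
  have hgM : in_ideal [:: M ^+ k] g.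
    apply: (hind j1 i c j2 g ejs dg).
    rewrite -[_ * g](subrK (M ^+ k * f)); apply: in_idealD.
      rewrite -opprB [_ * g]mulrC; apply: in_idealN; apply: in_ideal_sub eg => y.
      rewrite -powersE /powers map_rcons mem_rcons inE /fam map_cat map_cat mem_cat.
      by move=> ->; rewrite !orbT.
    apply/in_idealMr/in_ideal_gen.
    by rewrite /powers map_rcons mem_rcons inE eqxx.
  have [le|lt] := leqP c d; last first.
    move: dg; rewrite /deg_rep leqNgt lt /= => /eqP ->; exists 0; rewrite ?mul0r //.
    by rewrite eqxx dhomog0 if_same.
  have hg : g \is (d - c).-homog by move: dg; rewrite /deg_rep le.
  have [h dh /in_ideal_nil/eqP] :=
    @in_ideal_cons_homog K [::] _ _ _ _ isT hM hg hgM.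
  rewrite subr_eq0 => /eqP ->; exists h => //; exact: deg_rep_shift hL le dh.
apply/in_ideal_cons; exists h; rewrite -powersE.
apply: (IH (rcons j1 (i, c))); first by rewrite cat_rcons.
  exact: deg_repB.
rewrite powersE; have -> // : M ^+ k * (f - h * linform (kc v i) ^+ c) =
  M ^+ k * f - g * linform (kc v i) ^+ c by rewrite gE; ring.
Qed.

Lemma indep_last_mult_inj v iM k js i c d : indep_at v iM k (rcons js (i, c)) d ->
  mult_inj (powers (rcons (fam v js) (kc v iM, k))) (linform (kc v i) ^+ c) c d.
Proof.
move=> hind f hf hin; have := hind js i c [::] f; rewrite cats0 cats1.
move=> /(_ erefl hf hin); apply: in_ideal_sub => y; rewrite inE => /eqP ->.
by rewrite /powers map_rcons mem_rcons inE eqxx.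
Qed.

End FromGeneralPosition.

(** * The three equivalences, deduced formally from facts in general position *)

Section MaximalRank.
Variable K : fieldType.
Notation R := {mpoly K[3]}.
Implicit Types (f F G : R) (r : seq (R * nat)) (c d e j k : nat).

Lemma full_max_rank r F c j : homog_sys r -> F \is c.-homog ->
  full (F :: unzip1 r) j -> max_rank (unzip1 r) F c j.
Proof. by move=> hr hF h; right; apply/max_rank_surjE. Qed.

Lemma full_swap (gs : seq R) F G j :
  full (F :: rcons gs G) j <-> full (G :: rcons gs F) j.
Proof.
have H A B : full (A :: rcons gs B) j -> full (B :: rcons gs A) j.
  apply: full_trans => x; rewrite inE mem_rcons inE => hx; apply: in_ideal_gen.
  by rewrite inE mem_rcons inE orbCA.
by split; apply: H.
Qed.

Lemma homog_lin F k : F \is (1%N).-homog -> F ^+ k \is k.-homog.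
Proof. by move=> /(dhomogMn k); rewrite mul1n. Qed.

(** Here [p] stands for p(A) and [p' b] for p(A / L^b A). The hypotheses collect what general
    position provides. *)
Variables (r : seq (R * nat)) (ell L : R) (p : nat) (p' : nat -> nat).
Local Notation g := (unzip1 r).
Hypotheses (hr : homog_sys r) (hell : ell \is (1%N).-homog) (hL : L \is (1%N).-homog).
Hypothesis le_p' : forall b, (0 < b)%N -> (p' b <= p)%N.
Hypothesis inj_ell : forall d, (d <= p)%N -> mult_inj g ell 1 d.
Hypothesis full_ell : forall d, (p < d)%N -> full (ell :: g) d.
Hypothesis inj_L : forall d, (d <= p)%N -> mult_inj g L 1 d.
Hypothesis inj_ell_Lb : forall b d, (3 <= b <= p)%N -> (d <= p' b)%N ->
  mult_inj (rcons g (L ^+ b)) ell 1 d.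
Hypothesis full_ell_Lb : forall b d, (3 <= b <= p)%N -> (p' b < d)%N ->
  full (ell :: rcons g (L ^+ b)) d.
Hypothesis top_Lb : forall b, (3 <= b <= p)%N ->
  max_rank (rcons g (L ^+ b)) (ell ^+ 3) 3 (p' b).+1.
Hypothesis top_cube : full (ell ^+ 3 :: g) p.+1 \/
  mult_inj g (ell ^+ 3) 3 p.+1 /\ mult_inj g (L ^+ 3) 3 p.+1.
Hypothesis socle_cube : full (L ^+ p.+2 :: rcons g (ell ^+ 3)) p.+2.
Hypothesis rank_L1 : forall j, max_rank (rcons g (ell ^+ 3)) (L ^+ 1) 1 j.
Hypothesis rank_L2 : forall j, max_rank (rcons g (ell ^+ 3)) (L ^+ 2) 2 j.
Hypothesis rank_top : max_rank (rcons g (ell ^+ 3)) (L ^+ p.+1) p.+1 p.+1.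

Let strong := forall d j, (0 < d)%N -> max_rank (rcons g (ell ^+ 3)) (L ^+ d) d j.
Let all_cubes := forall b, (3 <= b <= p)%N -> forall j,
  max_rank (rcons g (L ^+ b)) (ell ^+ 3) 3 j.
Let critical_cubes := forall b, (3 <= b <= p)%N ->
  max_rank (rcons g (L ^+ b)) (ell ^+ 3) 3 (p' b).+2.

Let unzip1_rcons F c : unzip1 (rcons r (F, c)) = rcons g F.
Proof. exact: map_rcons. Qed.

Let homog_rcons F c : F \is c.-homog -> homog_sys (rcons r (F, c)).
Proof. by rewrite homog_sys_rcons hr andbT. Qed.

Let surj_rcons F c G e j : F \is c.-homog -> G \is e.-homog ->
  mult_surj (rcons g F) G e j <-> full (G :: rcons g F) j.
Proof.
move=> hF hG; rewrite -(unzip1_rcons F c); apply: max_rank_surjE => //.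
exact: homog_rcons.
Qed.

Let full_cube_large j : (p + 3 <= j)%N -> full (ell ^+ 3 :: g) j.
Proof. by move=> h; apply: full_pow h. Qed.

Let full_cube_weaken F j : full (ell ^+ 3 :: g) j -> full (F :: rcons g (ell ^+ 3)) j.
Proof.
apply: full_trans => x; rewrite inE => hx; apply: in_ideal_gen.
by rewrite inE mem_rcons inE hx orbT.
Qed.

Let hell3 := homog_lin 3 hell.

Let full_socle b : (b <= p.+2)%N -> full (L ^+ b :: rcons g (ell ^+ 3)) p.+2.
Proof.
move=> le; apply: full_trans socle_cube => x; rewrite inE => /predU1P[->|hx].
  by rewrite -(subnKC le) exprD; apply/in_idealMr/in_ideal_gen; rewrite inE eqxx.
by apply: in_ideal_gen; rewrite inE hx orbT.
Qed.

(** Up to degree [p' b] the cube is a composite of injections, and from [p' b + 3] on a composite of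
    surjections. Degree [p' b + 1] is known and [p' b + 2] is the assumption. *)
Lemma critical_all : critical_cubes -> all_cubes.
Proof.
move=> hc b hb j; have hLb := homog_lin b hL.
have [le|lt] := leqP j (p' b).
  by left; apply: (mult_inj_pow (p := p' b)) => // d hd; apply: inj_ell_Lb.
case: (ltngtP j (p' b).+1) => [|gt1|->]; [lia| |exact: top_Lb].
case: (ltngtP j (p' b).+2) => [|gt2|->]; [lia| |exact: hc].
right; apply/(surj_rcons _ hLb hell3).
rewrite -(unzip1_rcons (L ^+ b) b); apply: (full_pow (p := p' b)) => //.
- exact: homog_rcons.
- by move=> i hi; rewrite unzip1_rcons; apply: full_ell_Lb.
- by rewrite addnS addn2.
Qed.

(** Surjectivity passes between the two multiplications because they share a cokernel; injectivity
    passes by exchange, given that ell^3 is injective on A. If [p' b = p], the target degree p + 2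
    is filled. *)
Lemma strong_critical : strong -> critical_cubes.
Proof.
move=> hs b hb; have hLb := homog_lin b hL; have lep := @le_p' b ltac:(lia).
have [e|ne] := eqVneq (p' b) p.
  rewrite e; right; apply/(surj_rcons _ hLb hell3)/full_swap.
  by apply: full_socle; lia.
have lt : (p' b < p)%N by rewrite ltn_neqAle ne.
have [] := hs b (p' b).+2 ltac:(lia); last first.
  by move/(surj_rcons _ hell3 hLb)/full_swap/(surj_rcons _ hLb hell3); right.
move=> inj; have [le|gt] := leqP (p' b).+2 p.
  by left; apply: mult_inj_exchange inj _ => //; apply: mult_inj_pow le.
have e : (p' b).+2 = p.+1 by lia.
rewrite e in inj *; case: top_cube => [h|[h _]].
  by right; apply/(surj_rcons _ hLb hell3)/full_swap/full_cube_weaken.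
by left; apply: mult_inj_exchange inj h.
Qed.

(** Exponents 1, 2 and p + 1 and degrees from p + 2 on are settled directly; the exponents between 3
    and [p] come from the cubes by the same exchange, given that L^d is injective on A. *)
Lemma all_strong : all_cubes -> strong.
Proof.
move=> hb d j d0; have hLd := homog_lin d hL.
have surj : full (L ^+ d :: rcons g (ell ^+ 3)) j ->
    max_rank (rcons g (ell ^+ 3)) (L ^+ d) d j.
  by move/(surj_rcons _ hell3 hLd); right.
have [large|small] := leqP (p + 3) j.
  exact/surj/full_cube_weaken/full_cube_large.
have [lt|le] := ltnP j d.
  left=> f; rewrite /deg_rep leqNgt lt /= => /eqP-> _; exact: in_ideal0.
case: d d0 hLd surj le => [|[|[|d]]] // _ hLd surj le.
have [e|nj] := eqVneq j p.+2; first by apply: surj; rewrite e; apply: full_socle; lia.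
have [e|nd] := eqVneq d.+3 p.+1; first by rewrite e (_ : j = p.+1) //; lia.
have hd : (3 <= d.+3 <= p)%N by lia.
have [inj|] := hb _ hd j; last first.
  by move/(surj_rcons _ hLd hell3)/full_swap/surj.
have [lej|gt] := leqP j p.
  by left; apply: mult_inj_exchange inj _ => //; apply: mult_inj_pow lej.
have e : j = p.+1 by lia.
case: top_cube => [h|[_ h]]; first by apply/surj/full_cube_weaken; rewrite e.
left; apply: mult_inj_exchange inj _ => //; rewrite e -[d.+3]/(3 + d)%N.
apply: mult_inj_comp => //; apply: (mult_inj_pow (p := p)) => //; lia.
Qed.

End MaximalRank.

(** * Maximal rank in terms of dimensions *)

Section RankComparison.
Variable K : fieldType.
Notation R := {mpoly K[3]}.
Notation form := ('I_3 -> K).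
Implicit Types (F G : R) (r : seq (R * nat)) (d j : nat).

Lemma mem_colon r F d j (x : dhomog 3 K (j - d)) : homog_sys r -> F \is d.-homog ->
  (d <= j)%N ->
  x \in (mulHom d j F @^-1: gen_space r j)%VS <-> in_ideal (unzip1 r) (F * val x).
Proof.
move=> hr hF le; have := mem_gen_space hr (dhomog_is_dhomog (mulHom d j F x)).
by rewrite valH mulHomE // -memv_preim => h; split=> /h.
Qed.

Lemma max_rank_trivial (gs : seq R) F d j : (j < d)%N -> max_rank gs F d j.
Proof.
move=> lt; left=> f; rewrite /deg_rep leqNgt lt /= => /eqP-> _; exact: in_ideal0.
Qed.

(* Maximal rank means that the ideal generated by [r] and [F] is as large as
   possible in degree [j]. *)
Lemma max_rank_le_dim r F G d j : homog_sys r -> F \is d.-homog -> G \is d.-homog ->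
  (\dim (gen_space ((F, d) :: r) j) <= \dim (gen_space ((G, d) :: r) j))%N ->
  max_rank (unzip1 r) F d j -> max_rank (unzip1 r) G d j.
Proof.
move=> hr hF hG hdim; have [le|lt _] := leqP d j; last exact: max_rank_trivial.
have hrF : homog_sys ((F, d) :: r) by rewrite /= hF.
have hrG : homog_sys ((G, d) :: r) by rewrite /= hG.
case=> [inj|/(max_rank_surjE _ hr hF)/(full_dim _ hrF) e]; last first.
  right; apply/(max_rank_surjE _ hr hG)/(full_dim _ hrG)/eqP.
  by rewrite eqn_leq -{2}e hdim -(dimH K) dimvS ?subvf.
left; move: hdim; rewrite !gen_space_cons /= le => hdim.
have eF := dim_preim (mulHom d j F) (gen_space r j).
have eG := dim_preim (mulHom d j G) (gen_space r j).
have subF : (mulHom d j F @^-1: gen_space r j <= gen_space r (j - d))%VS.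
  apply/subvP => x /(mem_colon x hr hF le) hx; rewrite -(valH x).
  apply/mem_gen_space => //; first exact: dhomog_is_dhomog.
  by apply: inj => //; rewrite /deg_rep le; apply: dhomog_is_dhomog.
have subG : (gen_space r (j - d) <= mulHom d j G @^-1: gen_space r j)%VS.
  apply/subvP => x; rewrite -{1}(valH x) => hx; apply/(mem_colon x hr hG le).
  by apply/in_idealMl/(mem_gen_space hr (dhomog_is_dhomog x)).
have /eqP eqG : gen_space r (j - d) == (mulHom d j G @^-1: gen_space r j)%VS.
  rewrite eqEdim subG; have := dimvS subF; move: eF eG hdim.
  move: (\dim (limg _ + _)%VS) (\dim (limg _ + _)%VS) (\dim (_ @^-1: _)%VS)
    (\dim (_ @^-1: _)%VS) (\dim (gen_space _ _)) (\dim (gen_space _ _)) (\dim fullv).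
  lia.
move=> f; rewrite /deg_rep le => hf hin.
apply/(mem_gen_space hr hf); rewrite eqG; apply/(mem_colon _ hr hG le).
by rewrite toHK.
Qed.

(** An ideal with at most one such generator is a proper principal ideal or zero and fills no
    degree; hence s <= 1 contradicts artinian. *)
Lemma not_full_small (s : seq (form * nat)) d : (size s <= 1)%N ->
  all (leq 1) (unzip2 s) -> ~ full (powers s) d.
Proof.
rewrite powersE => sz pos /(full_dim _ (psys_homog s)).
have hd_gt0 e : (0 < hd e)%N by rewrite bin_gt0; lia.
case: s sz pos => [|[c k] [|//]] _ /=.
  by rewrite /gen_space big_nil dimv0 => _ e; have := hd_gt0 d; rewrite -e.
rewrite andbT => k0; rewrite gen_space_cons /gen_space big_nil /=.
case: ifP => [le|_]; last by rewrite dimv0 => e; have := hd_gt0 d; rewrite -e.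
rewrite addv0 => e; have := limg_ker_dim (mulHom k d (linform c ^+ k)) fullv.
rewrite e dimH; case: d le {e} => [|d] le; first lia.
have : (hd (d.+1 - k) <= hd d)%N by apply: leq_bin2l; lia.
by rewrite hdS; lia.
Qed.

End RankComparison.

(** * Nonzero polynomials have nonvanishing points in characteristic zero *)

Section NonvanishingPoint.
Variable K : fieldType.
Hypothesis charK : [pchar K] =i pred0.

Lemma poly_nonroot (q : {poly K}) : q != 0 -> exists t, q.[t] != 0.
Proof.
move=> nq; pose rs := [seq (i%:R : K) | i <- iota 0 (size q)].
have [/allP h|/allPn[t _ ht]] := boolP (all (root q) rs); last by exists t.
have := max_poly_roots nq (introT allP h).
rewrite map_inj_uniq ?iota_uniq; last by move=> i j /eqP; rewrite natr_inj // => /eqP.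
by rewrite size_map size_iota ltnn => /(_ isT).
Qed.

Lemma digit_inj (N a a' x x' : nat) : (a + N * x = a' + N * x')%N ->
  (a < N)%N -> (a' < N)%N -> a = a' /\ x = x'.
Proof.
move=> e la la'; have ea : a = a'.
  have := congr1 (modn^~ N) e.
  by rewrite !(addnC _ (N * _)%N) !(mulnC N) !modnMDl !modn_small.
split=> //; move: e; rewrite ea => /addnI/eqP; rewrite eqn_pmul2l; [by move/eqP | lia].
Qed.

(* Kronecker substitution. *)
Lemma mpoly3_nonvanishing (f : {mpoly K[3]}) : f != 0 -> exists c, f.@[c] != 0.
Proof.
move=> nf; pose N := msize f.
pose phi (m : 'X_{1..3}) := (\sum_(i < 3) N ^ i * m i)%N.
have phi_inj : {in msupp f &, injective phi}.
  move=> m m' hm hm'.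
  have lt (m0 : 'X_{1..3}) i : m0 \in msupp f -> (m0 i < N)%N.
    move=> h; apply: leq_ltn_trans (msize_mdeg_lt h).
    by rewrite mdegE (bigD1 i) //= leq_addr.
  have phiE (m0 : 'X_{1..3}) : phi m0 = (m0 ord0 + N * (m0 (lift ord0 ord0) +
      N * m0 (lift ord0 (lift ord0 ord0))))%N.
    rewrite /phi !big_ord_recl big_ord0 /= /bump /= !addn0 expn0 expn1 mul1n.
    by rewrite mulnDr mulnA.
  rewrite !phiE => /digit_inj[||e0 /digit_inj[||e1 e2]]; try exact: lt.
  apply/mnmP => i; case: i => [[|[|[|//]]] hi].
  - by rewrite (_ : Ordinal hi = ord0) //; apply/val_inj.
  - by rewrite (_ : Ordinal hi = lift ord0 ord0) //; apply/val_inj.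
  - by rewrite (_ : Ordinal hi = lift ord0 (lift ord0 ord0)) //; apply/val_inj.
pose q : {poly K} := \sum_(m <- msupp f) f@_m *: 'X^(phi m).
have [m hm] : exists m, m \in msupp f.
  by exists (mlead f); apply: mlead_supp.
have nq : q != 0.
  apply/eqP => e; have := congr1 (coefp (phi m)) e.
  rewrite /= coef0 coef_sum (bigD1_seq m) ?msupp_uniq //= coefZ coefXn eqxx mulr1.
  rewrite big_seq_cond big1 ?addr0 => [h|m' /andP[hm' ne]].
    by move: hm; rewrite mcoeff_msupp h eqxx.
  rewrite coefZ coefXn; case: eqP => [/(phi_inj _ _ hm hm') e'|_]; last exact: mulr0.
  by rewrite e' eqxx in ne.
have [t ht] := poly_nonroot nq.
(* [N] exceeds every exponent of [f], so [phi] encodes a monomial by its digits in base N and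
   evaluation at (t, t^N, t^(N^2)) loses nothing. *)
exists (fun i => t ^+ (N ^ i)); apply: contra_neq ht => e.
rewrite horner_sum -[RHS]e mevalE; apply: eq_bigr => m' _.
rewrite hornerZ hornerXn; congr (_ * _); rewrite /phi expr_sum.
by apply: eq_bigr => i _; rewrite exprM.
Qed.

End NonvanishingPoint.

(** * General systems in the critical degrees *)

Section GeneralSystems.
Variables (K : fieldType) (S : nat).
Hypothesis charK : [pchar K] =i pred0.
Notation V := ('I_(3 * S) -> K).
Implicit Types (js : seq (nat * nat)) (v : V).

Lemma fills_rcons v iM k js d :
  fills_at v iM k js d <-> full (linform (kc v iM) ^+ k :: powers (fam v js)) d.
Proof.
rewrite /fills_at /powers map_rcons.
by split; apply: full_trans => x; [rewrite mem_rcons|rewrite -mem_rcons];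
  apply: in_ideal_gen.
Qed.

Lemma admissible_lt iM js : admissible S iM js -> (iM < S)%N.
Proof. by case/and3P=> _ /andP[]. Qed.

Lemma general_line js iM (p := p_of (unzip2 js)) :
  admissible S iM js -> (1 < size js)%N ->
  general (fun v : V =>
    (forall d, (d <= p)%N -> mult_inj (powers (fam v js)) (linform (kc v iM)) 1 d) /\
    (forall d, (p < d)%N -> full (linform (kc v iM) :: powers (fam v js)) d)).
Proof.
move=> hj sz; have sz2 : (1 < size (unzip2 js))%N by rewrite size_map.
have /and3P[_ _ pos] := hj.
(* Degrees up to p + 1 are enough, since fullness propagates upwards. *)
have G := general_bounded (N := p.+2) (fun d _ => general_forms1 charK d hj).
apply: generalW (generalI G (general_neq0 K (admissible_lt hj))) => v [h nM].
split=> [d le|d lt].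
  have := h d ltac:(lia); rewrite -p_condE -leq_p_of // le.
  by move/(indep_mult_inj nM); rewrite expr1.
apply: (full_mono lt); have := h p.+1 (leqnn _).
by rewrite -p_condE -leq_p_of // ltnn => /fills_rcons; rewrite expr1.
Qed.

Lemma general_square js iM (p := p_of (unzip2 js)) :
  admissible S iM js -> (1 < size js)%N ->
  general (fun v : V =>
    max_rank (powers (fam v js)) (linform (kc v iM) ^+ 2) 2 p.+1).
Proof.
move=> hj sz; have sz2 : (1 < size (unzip2 js))%N by rewrite size_map.
have /and3P[_ _ pos] := hj.
have [hE _] := p_of_bounds sz2 pos.
have G := general_forms2 charK hj (ltn0Sn p) (leqW hE).
apply: generalW (generalI G (general_neq0 K (admissible_lt hj))) => v [h nM].
move: h; case: ifP => _ h; last by left; apply: indep_mult_inj.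
rewrite powersE; apply: full_max_rank; first exact: psys_homog.
  exact: linformX_homog.
by rewrite -powersE; apply/fills_rcons.
Qed.

(** For [d > 0], total weight at least 3d, the dimension of [R/(M^3)]_d. *)
Definition cube_overdetermined cs d : bool :=
  (3 * d <= 3 * \sum_(c <- cs) (d.-1 - c) + 3 * count (fun c => c < d) cs
            + count (fun c => c == d) cs)%N.

Lemma general_cube js iM (p := p_of (unzip2 js)) :
  admissible S iM js -> (1 < size js)%N ->
  general (fun v : V => if cube_overdetermined (unzip2 js) p.+1
    then fills_at v iM 3 js p.+1 else indep_at v iM 3 js p.+1).
Proof.
move=> hj sz; have sz2 : (1 < size (unzip2 js))%N by rewrite size_map.
have /and3P[_ _ pos] := hj.
have [hE _] := p_of_bounds sz2 pos.
by apply: (general_forms3 charK hj); rewrite /= ltnS -sum_succ.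
Qed.

Lemma cube_max_rank js iM v d : linform (kc v iM) != 0 ->
  (if cube_overdetermined (unzip2 js) d
   then fills_at v iM 3 js d else indep_at v iM 3 js d) ->
  max_rank (powers (fam v js)) (linform (kc v iM) ^+ 3) 3 d.
Proof.
move=> nM; case: ifP => _ h; last by left; apply: indep_mult_inj.
rewrite powersE; apply: full_max_rank; first exact: psys_homog.
  exact: linformX_homog.
by rewrite -powersE; apply/fills_rcons.
Qed.

(** By maximality of p, the exponents overfill degree p + 2; the added power of degree p + 2 is the
    simple point that removes a possible double curve. *)
Lemma general_socle js iM iL (p := p_of (unzip2 js)) :
  admissible S iM (rcons js (iL, p.+2)) -> (1 < size js)%N ->
  general (fun v : V => fills_at v iM 3 (rcons js (iL, p.+2)) p.+2).
Proof.
move=> hj sz; have sz2 : (1 < size (unzip2 js))%N by rewrite size_map.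
have /and3P[_ _] := hj; rewrite /unzip2 map_rcons all_rcons /= => pos.
have [hE1 hE2] := p_of_bounds sz2 pos.
apply: (general_forms3_excess charK hj);
  rewrite /unzip2 map_rcons -cats1 ?big_cat ?count_cat /= ?big_seq1.
- rewrite (_ : (p.+2.-1 - p.+2 = 0)%N); last lia.
  by rewrite addn0 ltnS; apply: leqW.
- move: hE2; rewrite sum_succ -/p => h; apply: leq_trans h _.
  by apply: leq_add; apply: leq_addr.
- by rewrite mem_cat inE eqxx orbT.
Qed.

(** Each of the finitely many thresholds is either never attained or attained on a nonempty open
    set; excluded middle decides which. *)
Lemma general_max_dim (fs : seq ((V -> 'I_3 -> K) * nat)) j : poly_coords fs ->
  general (fun v => forall v0, \dim (gen_space (psys (inst fs v0)) j) <=
                               \dim (gen_space (psys (inst fs v)) j))%N.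
Proof.
move=> hfs; pose r v := \dim (gen_space (psys (inst fs v)) j).
have G : general (fun v => forall t, (t < (hd j).+1)%N ->
    (exists v0, t <= r v0)%N -> (t <= r v)%N).
  apply: general_bounded => t _.
  have [[v0 h0]|no] := Classical_Prop.classic (exists v0, (t <= r v0)%N).
    by apply: generalW (zopen_general (zopen_dim_inst hfs) h0).
  by apply: generalT => v /no.
apply: generalW G => v h v0; apply: h; last by exists v0.
by rewrite ltnS -(dimH K) dimvS ?subvf.
Qed.

End GeneralSystems.

(** * The Strong Lefschetz Property tested on a single general form *)

Section StrongLefschetz.
Variables (K : fieldType) (S : nat).
Hypothesis charK : [pchar K] =i pred0.
Notation V := ('I_(3 * S) -> K).
Implicit Types (js : seq (nat * nat)) (v : V).

(* The ranks attained by a general [c] are already attained by the [iL]-th form,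
   because the whole configuration is general. *)
Lemma general_SLP js iL N : (iL < S)%N -> iL \notin unzip1 js ->
  all (gtn S) (unzip1 js) ->
  general (fun v : V =>
    (forall j, (N <= j)%N -> full (powers (fam v js)) j) ->
    SLP (powers (fam v js)) <->
    forall d j, (0 < d)%N ->
      max_rank (powers (fam v js)) (linform (kc v iL) ^+ d) d j).
Proof.
move=> ltL nL /allP ltj.
have G := general_bounded (N := N) (fun d _ =>
  general_bounded (N := N) (fun j _ =>
    general_max_dim j (poly_coords_famf K S ((iL, d) :: js)))).
apply: generalW G => v hmax hN.
have hom := psys_homog (fam v js).
have large F d j : F \is d.-homog -> (N <= j)%N -> max_rank (powers (fam v js)) F d j.
  move=> hF le; rewrite powersE; apply: full_max_rank => // f hf.
  by apply: in_ideal_sub (hN j le f hf) => x; rewrite inE powersE => ->; rewrite orbT.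
split=> [[f [nf hf]] d j d0|hL].
  have [le|ltN] := leqP N j; first exact/large/le/linformX_homog.
  have [le|lt] := leqP d j; last exact: max_rank_trivial.
  have [c hc] := mpoly3_nonvanishing charK nf.
  (* Only the [iL]-th form is changed, to [c]; the algebra stays the same. *)
  pose v0 := point_of (fun k => if k == iL then c else kc v k) : V.
  have ejs : psys (fam v0 js) = psys (fam v js).
    rewrite /psys /fam -!map_comp; apply/eq_in_map => -[k e] hk /=.
    have kin : k \in unzip1 js by apply: (map_f fst hk).
    rewrite (eq_linform (fun i => kc_point _ i (ltj _ kin))).
    by rewrite ifN //; apply: contraNneq nL => <-.
  have eL : linform (kc v0 iL) = linform c.
    by rewrite (eq_linform (fun i => kc_point _ i ltL)) eqxx.
  have := hmax d ltac:(lia) j ltN v0; rewrite !inst_famf /= ejs eL => hdim.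
  rewrite powersE; apply: max_rank_le_dim hdim _; rewrite ?linformX_homog //.
  by rewrite -powersE; apply: hf.
(* Conversely, the dimensions reached by the [iL]-th form are reached by a general [c], by openness
   around that form. *)
pose D d j := \dim (gen_space ((linform (kc v iL) ^+ d, d) :: psys (fam v js)) j).
pose fs d : seq ((('I_3 -> K) -> 'I_3 -> K) * nat) := (id, d) :: constf 3 (fam v js).
have pfs d : poly_coords (fs d).
  split; last exact: poly_coords_const.
  by move=> i; exists 'X_i => c; rewrite mevalXU.
have einst d c : inst (fs d) c = (c, d) :: fam v js by rewrite /= inst_constf.
have G := general_bounded (N := N) (fun d _ =>
  general_bounded (N := N) (fun j _ =>
    zopen_general (v0 := kc v iL) (zopen_dim_inst (d := j) (t := D d j) (pfs d))
      ltac:(by rewrite /D /= inst_constf))).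
apply: generalW G => c hc d d0 j.
have [le|ltN] := leqP N j; first exact/large/le/linformX_homog.
have [le|lt] := leqP d j; last exact: max_rank_trivial.
have := hc d ltac:(lia) j ltN; rewrite einst => hdim.
rewrite powersE; apply: max_rank_le_dim hdim _; rewrite ?linformX_homog //.
by rewrite -powersE; apply: hL.
Qed.

End StrongLefschetz.

(* Parameter point v in K^(3(s+2)): forms 0..s-1 are L_1..L_s, form s is ell,
   form s+1 is L. *)
Theorem theorem7p5 (K : fieldType) (Hchar : [pchar K] =i pred0)
  (s : nat) (a : 'I_s -> nat) (Ha : forall i, (0 < a i)%N) :
  general (fun v : 'I_(3 * s.+2) -> K =>
    let I := [seq kth_form v i ^+ a i | i : 'I_s <- enum 'I_s] in
    let ell := kth_form v s in
    let L := kth_form v s.+1 in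
    let aseq := [seq a i | i : 'I_s <- enum 'I_s] in
    artinian I ->
    (SLP (rcons I (ell ^+ 3)) <->
       (forall b : nat, (3 <= b <= p_of aseq)%N ->
          max_rank_all (rcons I (L ^+ b)) (ell ^+ 3) 3))
    /\
    ((forall b : nat, (3 <= b <= p_of aseq)%N ->
          max_rank_all (rcons I (L ^+ b)) (ell ^+ 3) 3) <->
     (forall b : nat, (3 <= b <= p_of aseq)%N ->
          max_rank (rcons I (L ^+ b)) (ell ^+ 3) 3 (p_of (rcons aseq b)).+2))).
Proof.
pose js := [seq (val i, a i) | i <- enum 'I_s].
pose aseq := [seq a i | i : 'I_s <- enum 'I_s]; pose p := p_of aseq.
have ejs (v : 'I_(3 * s.+2) -> K) :
    powers (fam v js) = [seq kth_form v i ^+ a i | i : 'I_s <- enum 'I_s].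
  by rewrite /powers /fam -!map_comp.
have u1 : unzip1 js = iota 0 s by rewrite /unzip1 -map_comp -val_enum_ord.
have u2 : unzip2 js = aseq by rewrite /unzip2 -map_comp.
have szj : size js = s by rewrite size_map size_enum_ord.
have sza : size aseq = s by rewrite size_map size_enum_ord.
have posa : all (leq 1) aseq by rewrite all_map; apply/allP => i _; apply: Ha.
have [s_small|s2] := leqP s 1.
  apply: generalT => v /= [N hN]; case: (@not_full_small K (fam v js) N).
  - by rewrite size_map szj.
  - by rewrite /unzip2 /fam -map_comp [map _ _]u2.
  by rewrite ejs.
have sj : (1 < size js)%N by rewrite szj.
have sa : (1 < size aseq)%N by rewrite sza.
have adm iM : iM \in [:: s; s.+1] -> admissible s.+2 iM js.
  move=> h; rewrite /admissible u1 u2 posa andbT /= mem_iota iota_uniq.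
  have hM : (s <= iM < s.+2)%N by move: h; rewrite !inE; lia.
  rewrite andbT; apply/and3P; split; [lia | lia |].
  by apply/allP => i; rewrite mem_iota /=; lia.
have adm2 iM y b : (iM == s) && (y == s.+1) || (iM == s.+1) && (y == s) ->
    (0 < b)%N -> admissible s.+2 iM (rcons js (y, b)).
  move=> h b0; rewrite /admissible /unzip1 /unzip2 !map_rcons [map fst _]u1 [map snd _]u2.
  rewrite all_rcons posa b0 /= mem_rcons inE mem_iota rcons_uniq mem_iota iota_uniq.
  rewrite all_rcons /= !andbT; apply/and4P; split; [lia | lia | lia |].
  by apply/allP => i; rewrite mem_iota /=; lia.
have szr x : (1 < size (rcons js x))%N by rewrite size_rcons; lia.
have ur y b : unzip2 (rcons js (y, b)) = rcons aseq b by rewrite /unzip2 map_rcons [map _ _]u2.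
have in_s : s \in [:: s; s.+1] by rewrite inE eqxx.
have in_s1 : s.+1 \in [:: s; s.+1] by rewrite !inE eqxx orbT.
have G1 := general_line Hchar (adm s in_s) sj.
have G2 := general_line Hchar (adm s.+1 in_s1) sj.
(* The exponent is [b.+1], so it runs from 1 to p + 1. *)
have G3 := general_bounded (N := p.+1) (fun b _ =>
  general_line Hchar (adm2 s s.+1 b.+1 ltac:(by rewrite !eqxx) isT) (szr _)).
have G4 := general_bounded (N := p.+1) (fun b _ =>
  general_cube Hchar (adm2 s s.+1 b.+1 ltac:(by rewrite !eqxx) isT) (szr _)).
have G5 := general_cube Hchar (adm s in_s) sj.
have G6 := general_cube Hchar (adm s.+1 in_s1) sj.
have G7 := general_socle Hchar (adm2 s s.+1 (p_of (unzip2 js)).+2 ltac:(by rewrite !eqxx) isT) sj.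
have G8 := general_line Hchar (adm2 s.+1 s 3%N ltac:(by rewrite !eqxx orbT) isT) (szr _).
have G9 := general_square Hchar (adm2 s.+1 s 3%N ltac:(by rewrite !eqxx orbT) isT) (szr _).
have nL : s.+1 \notin unzip1 (rcons js (s, 3%N)).
  by rewrite /unzip1 map_rcons [map _ _]u1 mem_rcons inE mem_iota /=; lia.
have ltj : all (gtn s.+2) (unzip1 (rcons js (s, 3%N))).
  by have /and3P[_ /andP[]] := adm2 s.+1 s 3%N ltac:(by rewrite !eqxx orbT) isT.
have GS := general_SLP Hchar (p + 3) (ltnSn s.+1) nL ltj.
have N1 := general_neq0 K (leqnSn s.+1 : (s < s.+2)%N).
have N2 := general_neq0 K (ltnSn s.+1).
have := generalI (generalI (generalI G1 G2) (generalI G3 G4))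
  (generalI (generalI (generalI G5 G6) G7)
  (generalI (generalI G8 G9) (generalI GS (generalI N1 N2)))).
apply: generalW => v [[[g1 g2] [g3 g4]] [[[g5 g6] g7] [[g8 g9] [gS [n1 n2]]]]] /= _.
rewrite -/aseq -/p -ejs; set ell := kth_form v s; set L := kth_form v s.+1.
have eB : powers (fam v (rcons js (s, 3%N))) = rcons (powers (fam v js)) (ell ^+ 3).
  by rewrite /powers /fam !map_rcons.
have eL b : powers (fam v (rcons js (s.+1, b))) = rcons (powers (fam v js)) (L ^+ b).
  by rewrite /powers /fam !map_rcons.
rewrite eB in g9 gS; rewrite u2 -/p in g1 g2 g5 g6 g7.
rewrite eB ur in g8; rewrite ur in g9.
have hell : ell \is (1%N).-homog by apply: linform_homog.
have hL : L \is (1%N).-homog by apply: linform_homog.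
set r := psys (fam v js); have hr : homog_sys r by apply: psys_homog.
have eI : powers (fam v js) = unzip1 r by apply: powersE.
rewrite eI in g1 g2 g8 g9 gS eB eL *.
pose p' b := p_of (rcons aseq b).
have le_p' b : (0 < b)%N -> (p' b <= p)%N by apply: p_of_rcons_le.
have g3b b : (3 <= b <= p)%N ->
    (forall d, (d <= p' b)%N -> mult_inj (rcons (unzip1 r) (L ^+ b)) ell 1 d) /\
    (forall d, (p' b < d)%N -> full (ell :: rcons (unzip1 r) (L ^+ b)) d).
  case: b => // b hb; have := g3 b ltac:(lia); by rewrite eL ur.
have g4b b : (3 <= b <= p)%N ->
    max_rank (rcons (unzip1 r) (L ^+ b)) (ell ^+ 3) 3 (p' b).+1.
  case: b => // b hb; have /(cube_max_rank n1) := g4 b ltac:(lia); by rewrite eL ur.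
(* For the exponent p + 1 one has p(A / L^(p+1) A) = p, so the cube statement for that system
   concerns exactly degree p + 1; there, either it fills or L^(p+1) is independent of the rest. *)
have rank_top : max_rank (rcons (unzip1 r) (ell ^+ 3)) (L ^+ p.+1) p.+1 p.+1.
  have := g4 p (leqnn _); rewrite ur p_of_rcons_top // -/p; case: ifP => _ h.
    right; rewrite -eB; rewrite powersE; apply/max_rank_surjE.
    - exact: psys_homog.
    - exact: linformX_homog.
    rewrite -powersE; apply: full_trans h => x; rewrite /powers /fam !map_rcons => hx.
    apply: in_ideal_gen; move: hx.
    by rewrite !mem_rcons !inE !mem_rcons !inE orbCA.
  by left; have := indep_last_mult_inj h; rewrite /powers map_rcons -/(powers _) eI.
have top_cube : full (ell ^+ 3 :: unzip1 r) p.+1 \/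
    mult_inj (unzip1 r) (ell ^+ 3) 3 p.+1 /\ mult_inj (unzip1 r) (L ^+ 3) 3 p.+1.
  move: g5 g6; case: ifP => _ h5 h6; first by left; move/fills_rcons: h5; rewrite powersE.
  by right; split; rewrite /r -powersE; apply: indep_mult_inj.
have socle : full (L ^+ p.+2 :: rcons (unzip1 r) (ell ^+ 3)) p.+2.
  by move/fills_rcons: g7; rewrite eL => /full_swap.
(* [p' 3] is also p(A / ell^3 A), because p depends on the exponents only. *)
have rank1 j : max_rank (rcons (unzip1 r) (ell ^+ 3)) (L ^+ 1) 1 j.
  have [h1 h2] := g8; have [le|lt] := leqP j (p' 3); first by left; apply: h1.
  right; rewrite -eB powersE; apply/max_rank_surjE.
  - exact: psys_homog.
  - exact: linform_homog.
  by rewrite -powersE eB; apply: h2.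
have rank2 j : max_rank (rcons (unzip1 r) (ell ^+ 3)) (L ^+ 2) 2 j.
  have [h1 h2] := g8; have [le|lt] := leqP j (p' 3).
    by left; apply: (mult_inj_pow (p := p' 3)).
  have [lt2|] := leqP (p' 3 + 2) j; last first.
    rewrite addn2 ltnS => h; have -> : j = (p' 3).+1 by lia.
    exact: g9.
  right; rewrite -eB powersE; apply/max_rank_surjE.
  - exact: psys_homog.
  - exact: linformX_homog.
  apply: (full_pow (p := p' 3)) => //; first exact: psys_homog.
  by rewrite -powersE eB.
(* A / ell^3 A vanishes from degree p + 3 on, the bound used for the Strong Lefschetz Property. *)
have small j : (p + 3 <= j)%N -> full (rcons (unzip1 r) (ell ^+ 3)) j.
  move=> le f hf; have [_ h2] := g1; have := full_pow hr hell h2 le hf.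
  by apply: in_ideal_sub => x; rewrite mem_rcons.
have [iS1 iS2] := gS small.
have [inj1 full1] := g1; have [inj2 _] := g2.
have crit := @critical_all K r ell L p p' hr hell hL
  (fun b d hb => (g3b b hb).1 d) (fun b d hb => (g3b b hb).2 d) g4b.
have strong := @strong_critical K r ell L p p' hr hell hL le_p' inj1 top_cube socle.
have all := @all_strong K r ell L p hr hell hL full1 inj2 top_cube socle rank1 rank2 rank_top.
split; split.
- by move=> h b hb j; apply: crit => //; apply: strong => d i; apply: iS1.
- by move=> h; apply: iS2; apply: all.
- by move=> h b hb; apply: h.
- by move=> h b hb j; apply: crit.
Qed.
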